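(* Let $\alpha>0$, $\mu<0$, $\sigma\in\mathbb{R}$, $\beta\in(0,1)$, $\gamma=\beta-\alpha\in[0,1)$ and $v_0>0$. Let $K:(0,\infty)^4\to[0,\infty)$ be continuous and satisfy, for all $(a,v,a',v')\in(0,\infty)^4$ and $\lambda>0$, $$K(\lambda^{2/3}a,\lambda v,\lambda^{2/3}a',\lambda v')=\lambda^{\gamma}K(a,v,a',v'),\qquad K(a,v,a',v')=K(a',v',a,v),$$ $$K_1(v^{-\alpha}v'^{\beta}+v'^{-\alpha}v^{\beta})\le K(a,v,a',v')\le K_0(v^{-\alpha}v'^{\beta}+v'^{-\alpha}v^{\beta})$$ for some constants $K_0,K_1>0$. Let $r\in C^1((0,\infty)^2)$ satisfy, for some constants $R_0,R_1>0$ and all $(a,v)\in(0,\infty)^2$, $\lambda>0$, $$R_0a^{\mu}v^{\sigma}\le r(a,v)\le R_1a^{\mu}v^{\sigma},\qquad r(\lambda^{2/3}a,\lambda v)=\lambda^{\gamma-1}r(a,v),\qquad \tfrac23\mu+\sigma=\gamma-1,$$ and, for some constant $B>0$ and all $(a,v)\in(0,\infty)^2$ with $a\ge c_0v^{2/3}$, $$\partial_ar(a,v)(a-c_0v^{2/3})+r(a,v)\ge0,\qquad \partial_ar(a,v)\le Ba^{-1}r(a,v).$$ Let $C_1(v_0)>0$ be the constant described in the context. Let $g\in C([0,\infty);\mathscr{M}_+^I((0,\infty)^2))$ be a weak solution of the time-dependent fusion problem in self-similar variables, with initial datum $g_{\rm in}:=g(\cdot,\cdot,0)$, with total volume of particles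 $\int_{(0,\infty)^2}v\,g(a,v,t)\,dv\,da=v_0$, and satisfying $$\sup_{t\in[0,\infty)}\int_{(0,\infty)^2}v^{x_1}g(a,v,t)\,dv\,da\le C_1(v_0)\quad\text{for } x_1\in\Big\{\frac{\sigma}{|\mu|},\gamma-\frac13\Big\}$$ and, for some $\tilde\epsilon\in(0,1)$ and every $T>0$, $$\sup_{t\in[0,T]}\int_{(0,\infty)^2}(a^{\mu}+a^2)\big(v^{-\alpha-1}+v^{\max\{1+\tilde\epsilon,\sigma+\frac23\}}\big)g(a,v,t)\,dv\,da<\infty.$$ Then there exists a constant $C_2(v_0)>0$, depending on $v_0,K_0,K_1,\gamma,\mu,\sigma$, such that if $$R_1\le v_0\qquad\text{and}\qquad\int_{(0,\infty)^2}a\,g_{\rm in}(a,v)\,dv\,da\ge C_2(v_0),$$ then for all $t\ge0$ $$\int_{(0,\infty)^2}a\,g(a,v,t)\,dv\,da\ge C_\mu C_2(v_0)e^{\frac13t}$$ for some constant $C_\mu>0$ depending on $\mu$.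
   Context: Notation: $c_0:=(36\pi)^{1/3}$, $\eta=(a,v)\in(0,\infty)^2$. Measures are written as if they had densities. $\mathscr{M}_+^I((0,\infty)^2)$ is the set of non-negative Radon measures $h$ on $(0,\infty)^2$ with $h(\{a<c_0v^{2/3}\})=0$, with the weak-$*$ topology. For a test function $\varphi$, $$\langle\mathbb{K}[g],\varphi\rangle:=\tfrac12\int_{(0,\infty)^2}\int_{(0,\infty)^2}K(a,v,a',v')\,[\varphi(a+a',v+v')-\varphi(a,v)-\varphi(a',v')]\,g(a',v')g(a,v)\,dv'da'dv\,da.$$ Weak solution. $g\in C([0,\infty);\mathscr{M}_+^I((0,\infty)^2))$ is a weak solution of the time-dependent fusion problem in self-similar variables if for every $T>0$, $\sup_{t\in[0,T]}\int(v^{-\alpha}+v^{\beta})g(a,v,t)\,dv\,da<\infty$ and for all $\varphi\in C_c^1([0,\infty);C_c^1((0,\infty)^2))$ and $t\ge0$ $$\int g(\eta,t)\varphi(\eta,t)d\eta-\int g(\eta,0)\varphi(\eta,0)d\eta-\int_0^t\!\!\int g(\eta,s)\partial_s\varphi(\eta,s)d\eta ds=\int_0^t\!\!\int g\varphi\,d\eta ds-\tfrac23\int_0^t\!\!\int g\,a\,\partial_a\varphi\,d\eta ds-\int_0^t\!\!\int g\,v\,\partial_v\varphi\,d\eta ds$$ $$+(1-\gamma)\int_0^t\langle\mathbb{K}[g](s),\varphi(s)\rangle ds+(1-\gamma)\int_0^t\!\!\int r(\eta)(c_0v^{2/3}-a)g(\eta,s)\partial_a\varphi(\eta,s)d\eta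 ds,$$ spatial integrals being over $(0,\infty)^2$. The constant $C_1(v_0)$. $C_1(v_0)>0$ is a fixed constant depending on $v_0,K_0,K_1,\gamma$ for which the following existence statement holds: whenever $g_{\rm in}\in\mathscr{M}_+^I((0,\infty)^2)$ has $\int v\,g_{\rm in}=v_0$, satisfies $\int v^{x_1}g_{\rm in}\,dv\,da\le C_1(v_0)$ for $x_1\in\{\sigma/|\mu|,\gamma-\frac13\}$ and $\int(a^\mu+a^2)(v^{-\alpha-1}+v^{\max\{1+\tilde\epsilon,\sigma+2/3\}})g_{\rm in}\,dv\,da<\infty$ for some $\tilde\epsilon\in(0,1)$, there is a weak solution $g$ with initial datum $g_{\rm in}$ satisfying $\sup_{t\ge0}\int v^{x_1}g(t)\,dv\,da\le C_1(v_0)$ and $\sup_{t\in[0,T]}\int(a^\mu+a^2)(v^{-\alpha-1}+v^{\max\{1+\tilde\epsilon,\sigma+2/3\}})g(t)\,dv\,da<\infty$ for every $T>0$. *)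

(* Defs.v *)
From HB Require Import structures.
From mathcomp Require Import all_boot all_order all_algebra.
From mathcomp Require Import all_classical all_reals all_analysis.
Set Implicit Arguments.
Unset Strict Implicit.
Unset Printing Implicit Defensive.
Import Order.TTheory GRing.Theory Num.Theory.
Import numFieldNormedType.Exports.
Local Open Scope classical_set_scope.
Local Open Scope ring_scope.

(* A point x : R * R of the phase space is x = (a, v). *)

Definition phase {R : realType} : set (R * R) :=
  [set x | 0 < x.1 /\ 0 < x.2].

Definition c0 {R : realType} : R := (36 * pi) `^ 3^-1.

(* Measures on (0,oo)^2 are represented by their extension by zero to the Borel
   sets of R * R. On (0,oo)^2, which is locally compact and second countable,
   a Borel measure is Radon iff it is finite on compact sets. *)
Notation plane_measure R := {measure set (R * R)%type -> \bar R}.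

Definition radon_phase {R : realType} (m : plane_measure R) : Prop :=
  m (~` phase) = 0%E /\
  forall A : set (R * R), compact A -> A `<=` phase -> (m A < +oo)%E.

Definition MplusI {R : realType} (m : plane_measure R) : Prop :=
  radon_phase m /\
  m [set x | phase x /\ x.1 < c0 * x.2 `^ (2 / 3)] = 0%E.

Definition moment {R : realType} (m : plane_measure R) (w : R -> R -> R)
    : \bar R :=
  (\int[m]_(x in phase) (w x.1 x.2)%:E)%E.

(* Values of functions outside phase are irrelevant throughout. *)
Definition compact_support {R : realType} (f : R * R -> R) : Prop :=
  exists A : set (R * R),
    [/\ compact A, A `<=` phase & forall x, phase x -> ~ A x -> f x = 0].

Definition Cc {R : realType} (f : R * R -> R) : Prop :=
  (forall x, phase x -> {for x, continuous f}) /\ compact_support f.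

(* g in C([0,oo); M_+^I), where M_+^I carries the weak-* topology given by
   duality with C_c((0,oo)^2). Only the values of g at times t >= 0 matter. *)
Definition MplusI_curve {R : realType} (g : R -> plane_measure R) : Prop :=
  (forall t : R, 0 <= t -> MplusI (g t)) /\
  (forall f : R * R -> R, Cc f ->
     {within `[0, +oo[, continuous (fun t : R => \int[g t]_(x in phase) f x)}).

Definition d_a {R : realType} (f : R * R -> R) (x : R * R) : R :=
  derive1 (fun a : R => f (a, x.2)) x.1.

Definition d_v {R : realType} (f : R * R -> R) (x : R * R) : R :=
  derive1 (fun v : R => f (x.1, v)) x.2.

Record class_C1 {R : realType} (f : R * R -> R) : Prop := {
  class_C1_derivable_a : forall x, phase x ->
    derivable (fun a : R => f (a, x.2)) x.1 1;
  class_C1_derivable_v : forall x, phase x ->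
    derivable (fun v : R => f (x.1, v)) x.2 1;
  class_C1_continuous : forall x, phase x -> {for x, continuous f};
  class_C1_continuous_a : forall x, phase x -> {for x, continuous (d_a f)};
  class_C1_continuous_v : forall x, phase x -> {for x, continuous (d_v f)}
}.

Definition C1_close {R : realType} (e : R) (f g : R * R -> R) : Prop :=
  forall x, phase x ->
    [/\ `|f x - g x| <= e, `|d_a f x - d_a g x| <= e
      & `|d_v f x - d_v g x| <= e].

(* phi in C_c^1([0,oo); C_c^1((0,oo)^2)) with time derivative dphi: a compactly
   supported curve t |-> phi t that is continuously differentiable on [0,oo)
   (one-sidedly at 0) for the topology of C_c^1((0,oo)^2). A convergent family
   in that space has its supports in a common compact set, so the topology is
   that of the C^1 norm once the support is fixed. *)
Record test_curve {R : realType} (phi dphi : R -> R * R -> R) : Prop := {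
  test_curve_support : exists (T : R) (A : set (R * R)),
    [/\ compact A, A `<=` phase
      & forall (t : R) x, 0 <= t -> phase x -> phi t x != 0 -> t <= T /\ A x];
  test_curve_C1 : forall t : R, 0 <= t -> class_C1 (phi t);
  test_curve_derivative_C1 : forall t : R, 0 <= t -> class_C1 (dphi t);
  test_curve_derivative : forall t e : R, 0 <= t -> 0 < e ->
    \forall h \near (0 : R)^', 0 <= t + h ->
      C1_close e (fun x => h^-1 * (phi (t + h) x - phi t x)) (dphi t);
  test_curve_derivative_continuous : forall t e : R, 0 <= t -> 0 < e ->
    \forall s \near t, 0 <= s -> C1_close e (dphi s) (dphi t)
}.

(* <K[m], phi> *)
Definition fusion {R : realType} (K : R * R -> R * R -> R)
    (m : plane_measure R) (phi : R * R -> R) : R :=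
  2^-1 * \int[m]_(x in phase) \int[m]_(y in phase)
    (K x y * (phi (x.1 + y.1, x.2 + y.2) - phi x - phi y)).

Definition locally_bounded_moment {R : realType} (g : R -> plane_measure R)
    (w : R -> R -> R) : Prop :=
  forall T : R, 0 < T ->
    (ereal_sup [set moment (g t) w | t in `[0%R, T]] < +oo)%E.

Definition weak_solution {R : realType} (alpha beta gamma : R)
    (K : R * R -> R * R -> R) (r : R * R -> R) (g : R -> plane_measure R)
    : Prop :=
  [/\ MplusI_curve g,
      locally_bounded_moment g (fun _ v => v `^ (- alpha) + v `^ beta)
    & forall phi dphi : R -> R * R -> R, test_curve phi dphi ->
      forall t : R, 0 <= t ->
      let time_int (F : R -> R) : R :=
        \int[lebesgue_measure]_(s in `[0, t]) F s in
      \int[g t]_(x in phase) phi t x - \int[g 0]_(x in phase) phi 0 x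
        - time_int (fun s => \int[g s]_(x in phase) dphi s x)
      = time_int (fun s => \int[g s]_(x in phase) phi s x)
        - 2 / 3 * time_int (fun s =>
            \int[g s]_(x in phase) (x.1 * d_a (phi s) x))
        - time_int (fun s => \int[g s]_(x in phase) (x.2 * d_v (phi s) x))
        + (1 - gamma) * time_int (fun s => fusion K (g s) (phi s))
        + (1 - gamma) * time_int (fun s => \int[g s]_(x in phase)
            (r x * (c0 * x.2 `^ (2 / 3) - x.1) * d_a (phi s) x))].

Record kernel_hyp {R : realType} (alpha beta gamma K0 K1 : R)
    (K : R * R -> R * R -> R) : Prop := {
  kernel_ge0 : forall x y, phase x -> phase y -> 0 <= K x y;
  kernel_continuous : forall x y, phase x -> phase y ->
    {for (x, y), continuous (fun p : (R * R) * (R * R) => K p.1 p.2)};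
  kernel_homogeneous : forall (lambda : R) x y,
    0 < lambda -> phase x -> phase y ->
    K (lambda `^ (2 / 3) * x.1, lambda * x.2)
      (lambda `^ (2 / 3) * y.1, lambda * y.2) = lambda `^ gamma * K x y;
  kernel_symmetric : forall x y, phase x -> phase y -> K x y = K y x;
  kernel_lower : forall x y, phase x -> phase y ->
    K1 * (x.2 `^ (- alpha) * y.2 `^ beta + y.2 `^ (- alpha) * x.2 `^ beta)
      <= K x y;
  kernel_upper : forall x y, phase x -> phase y ->
    K x y <=
    K0 * (x.2 `^ (- alpha) * y.2 `^ beta + y.2 `^ (- alpha) * x.2 `^ beta)
}.

Record rate_hyp {R : realType} (gamma mu sigma R0 R1 B : R)
    (r : R * R -> R) : Prop := {
  rate_C1 : class_C1 r;
  rate_lower : forall x, phase x -> R0 * x.1 `^ mu * x.2 `^ sigma <= r x;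
  rate_upper : forall x, phase x -> r x <= R1 * x.1 `^ mu * x.2 `^ sigma;
  rate_homogeneous : forall (lambda : R) x, 0 < lambda -> phase x ->
    r (lambda `^ (2 / 3) * x.1, lambda * x.2) = lambda `^ (gamma - 1) * r x;
  rate_monotone : forall x, phase x -> c0 * x.2 `^ (2 / 3) <= x.1 ->
    0 <= d_a r x * (x.1 - c0 * x.2 `^ (2 / 3)) + r x;
  rate_derivative_upper : forall x, phase x -> c0 * x.2 `^ (2 / 3) <= x.1 ->
    d_a r x <= B * x.1^-1 * r x
}.

Definition weight {R : realType} (alpha mu sigma eps a v : R) : R :=
  (a `^ mu + a ^+ 2)
  * (v `^ (- alpha - 1) + v `^ Num.max (1 + eps) (sigma + 2 / 3)).

Definition x1_set {R : realType} (gamma mu sigma : R) : set R :=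
  [set sigma / `|mu|; gamma - 3^-1].

(* The defining property of the constant C_1(v0), for given data K and r. *)
Definition C1_property {R : realType} (alpha beta gamma mu sigma v0 : R)
    (K : R * R -> R * R -> R) (r : R * R -> R) (C1 : R) : Prop :=
  0 < C1 /\
  forall (gin : plane_measure R) (eps : R),
    MplusI gin ->
    moment gin (fun _ v => v) = v0%:E ->
    (forall x1, x1_set gamma mu sigma x1 ->
       (moment gin (fun _ v => (v `^ x1)%R) <= C1%:E)%E) ->
    0 < eps < 1 ->
    (moment gin (weight alpha mu sigma eps) < +oo)%E ->
    exists g : R -> plane_measure R,
      [/\ weak_solution alpha beta gamma K r g,
          forall A : set (R * R), measurable A -> g 0 A = gin A,
          forall x1, x1_set gamma mu sigma x1 ->
            (ereal_sup [set moment (g t) (fun _ v => (v `^ x1)%R)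
                       | t in `[0%R, +oo[] <= C1%:E)%E
        & locally_bounded_moment g (weight alpha mu sigma eps)].

(* Main.v *)
Require Import Defs.
From HB Require Import structures.
From mathcomp Require Import all_boot all_order all_algebra.
From mathcomp Require Import all_classical all_reals all_analysis.
From mathcomp Require Import measurable_realfun ring lra.
Set Implicit Arguments.
Unset Strict Implicit.
Unset Printing Implicit Defensive.
Import Order.TTheory GRing.Theory Num.Theory.
Import numFieldNormedType.Exports.
Local Open Scope classical_set_scope.
Local Open Scope ring_scope.

(* Let M(t) be the total area. Fusion preserves area, so testing the equation
   with a gives M' = M/3 - (1-gamma) D with D = int r (a - c0 v^(2/3)) g >= 0.
   Hence N(t) = e^(-t/3) M(t) is nonincreasing. On the other hand
   D <= R1 int a^(mu+1) v^sigma g <= c M^(1-p) with p = min(|mu|,1): by Hoelder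
   if mu > -1, and because a >= c0 v^(2/3) on the support of g if mu <= -1.
   Inserting M(s) <= e^(s/3) M(0) bounds the total loss of N by
   (3c/p) M(0)^(1-p), which is at most M(0)/2 when M(0) is large.

   The function a is not an admissible test function. It is replaced by
   a q^2 with q = (1 - delta (a + 1/a + v^eps + 1/v))_+, multiplied by a time
   factor equal to e^(-s/3) on [0,t]. All errors are O(delta) uniformly on
   [0,t], as the weight of the moment hypothesis dominates them. The drift and
   fusion integrals are only bounded by explicit majorants, so the
   measurability of their integrands, also in time, plays no role. *)

(** * Integral estimates for possibly non-measurable integrands *)

(** Beyond the moments of the weight little is known about g(t), so each error has to be a sum of
    monomials a^i v^j whose exponents the weight covers. This dictates the truncation. Each of the
    four terms in q blows up at one end of the phase space, which gives compact support; the volume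
    enters as v^eps because the kernel factor v^beta times v^eps has order below 1 + eps. Squaring q
    turns a Lipschitz cutoff into a C^1 one. The terms of the equation reduce to errors because a is
    special for each of them: additive under fusion, homogeneous of degree one under a d/da,
    independent of v.

    The drift integral is never passed to the limit. The truncated area has slope in a between -2
    delta a and 1 + 2 delta / a, which gives two one-sided bounds for each delta, and delta -> 0 is
    taken only in a numerical inequality at fixed t. The loss is linear in R1, so R1 <= v0 allows a
    threshold that does not involve r. *)

Lemma ge0_le_integral_nomeas d (T : measurableType d) (R : realType)
    (m : {measure set T -> \bar R}) (D : set T) (f h : T -> \bar R) :
  (forall x, D x -> (0 <= f x)%E) -> (forall x, D x -> (f x <= h x)%E) ->
  (\int[m]_(x in D) f x <= \int[m]_(x in D) h x)%E.
Proof.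
move=> f0 fh.
have h0 x : D x -> (0 <= h x)%E by move=> Dx; exact: le_trans (f0 _ Dx) (fh _ Dx).
rewrite !ge0_integralE//.
(* The integral of a nonnegative function is a supremum over the simple functions below it,
   measurable or not, and this family grows with the function. *)
apply: ereal_sup_le => _ [s sf <-]; exists s => // x.
apply: (le_trans (sf x)); rewrite /patch; case: ifPn => //.
by rewrite inE; exact: fh.
Qed.

Lemma ge0_integral_majorant d (T : measurableType d) (R : realType)
    (m : {measure set T -> \bar R}) (D N : set T) (f : T -> \bar R)
    (h : T -> R) :
  measurable D -> measurable N -> m N = 0%E -> measurable_fun D h ->
  (forall x, D x -> (0 <= f x)%E) -> (forall x, D x -> 0 <= h x) ->
  (forall x, D x -> ~ N x -> (f x <= (h x)%:E)%E) ->
  (\int[m]_(x in D) f x <= \int[m]_(x in D) (h x)%:E)%E.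
Proof.
move=> mD mN N0 mh f0 h0 fh.
(* Raising the majorant to +oo on N makes the bound hold on all of D, at no cost since N is null. *)
pose n0 := (cst +oo%E \_ N : T -> \bar R).
have n00 x : (0 <= n0 x)%E by apply: erestrict_ge0 => y _; exact: leey.
have mn0 : measurable_fun D ((cst +oo%E : T -> \bar R) \_ N).
  by apply/measurable_restrict.
apply: (@le_trans _ _ (\int[m]_(x in D) ((h x)%:E + n0 x))%E).
  apply: ge0_le_integral_nomeas => // x Dx; rewrite /n0 /patch; case: ifPn.
    by move=> _; rewrite addey ?leey.
  by rewrite notin_setE adde0; exact: fh.
rewrite ge0_integralD//; last exact/measurable_EFinP.
rewrite -integral_mkcondr integral_cst; last exact: measurableI.
rewrite (_ : m (D `&` N) = 0%E) ?mule0 ?adde0//.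
by apply: (subset_measure0 _ mN) => //; exact: measurableI.
Qed.

Lemma ge0_integralZl_le d (T : measurableType d) (R : realType)
    (m : {measure set T -> \bar R}) (D : set T) (h : T -> R) (k c : R) :
  measurable D -> measurable_fun D h -> 0 <= k ->
  (forall x, D x -> 0 <= h x) -> (\int[m]_(x in D) (h x)%:E <= c%:E)%E ->
  (\int[m]_(x in D) (k * h x)%:E <= (k * c)%:E)%E.
Proof.
move=> mD mh k0 h0 hc; under eq_integral do rewrite EFinM.
rewrite ge0_integralZl//; last exact/measurable_EFinP.
by rewrite [leRHS]EFinM; exact: lee_wpmul2l.
Qed.

Lemma ge0_integralD_le d (T : measurableType d) (R : realType)
    (m : {measure set T -> \bar R}) (D : set T) (h1 h2 : T -> R) (c1 c2 : R) :
  measurable D -> measurable_fun D h1 -> measurable_fun D h2 ->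
  (forall x, D x -> 0 <= h1 x) -> (forall x, D x -> 0 <= h2 x) ->
  (\int[m]_(x in D) (h1 x)%:E <= c1%:E)%E ->
  (\int[m]_(x in D) (h2 x)%:E <= c2%:E)%E ->
  (\int[m]_(x in D) (h1 x + h2 x)%:E <= (c1 + c2)%:E)%E.
Proof.
move=> mD mh1 mh2 h10 h20 hc1 hc2; under eq_integral do rewrite EFinD.
rewrite [leRHS]EFinD ge0_integralD//; [exact: leeD|exact/measurable_EFinP|].
exact/measurable_EFinP.
Qed.

(** If the negative part has infinite integral, the extended integral is -oo and [fine] returns 0;
    the bound survives because c >= 0. *)
Lemma Rintegral_le_majorant d (T : measurableType d) (R : realType)
    (m : {measure set T -> \bar R}) (D N : set T) (f h : T -> R) (c : R) :
  measurable D -> measurable N -> m N = 0%E -> measurable_fun D h ->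
  (forall x, D x -> 0 <= h x) -> (forall x, D x -> ~ N x -> f x <= h x) ->
  (\int[m]_(x in D) (h x)%:E <= c%:E)%E ->
  \int[m]_(x in D) f x <= c.
Proof.
move=> mD mN N0 mh h0 fh hc.
have c0 : 0 <= c by rewrite -lee_fin (le_trans _ hc)// integral_ge0.
rewrite /Rintegral integralE.
have : (\int[m]_(x in D) (EFin \o f)^\+ x <= c%:E)%E.
  apply: le_trans hc; apply: (ge0_integral_majorant _ mN) => // x Dx Nx.
  by rewrite funeposE -EFin_max lee_fin ge_max h0// fh.
have : (0 <= \int[m]_(x in D) (EFin \o f)^\+ x)%E by exact: integral_ge0.
have : (0 <= \int[m]_(x in D) (EFin \o f)^\- x)%E by exact: integral_ge0.
case: integral => [a| |]//; case: integral => [b| |]//=.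
by rewrite !lee_fin; lra.
Qed.

Lemma Rintegral_ge_majorant d (T : measurableType d) (R : realType)
    (m : {measure set T -> \bar R}) (D N : set T) (f h : T -> R) (c : R) :
  measurable D -> measurable N -> m N = 0%E -> measurable_fun D h ->
  (forall x, D x -> 0 <= h x) -> (forall x, D x -> ~ N x -> - h x <= f x) ->
  (\int[m]_(x in D) (h x)%:E <= c%:E)%E ->
  - c <= \int[m]_(x in D) f x.
Proof.
move=> mD mN N0 mh h0 fh hc.
have c0 : 0 <= c by rewrite -lee_fin (le_trans _ hc)// integral_ge0.
rewrite /Rintegral integralE.
have : (\int[m]_(x in D) (EFin \o f)^\- x <= c%:E)%E.
  apply: le_trans hc; apply: (ge0_integral_majorant _ mN) => // x Dx Nx.
  by rewrite funenegE/= -EFin_max lee_fin ge_max h0// lerNl fh.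
have : (0 <= \int[m]_(x in D) (EFin \o f)^\+ x)%E by exact: integral_ge0.
have : (0 <= \int[m]_(x in D) (EFin \o f)^\- x)%E by exact: integral_ge0.
case: integral => [a| |]//; case: integral => [b| |]//=; rewrite ?lee_fin; try lra.
Qed.

Lemma normr_Rintegral_le_majorant d (T : measurableType d) (R : realType)
    (m : {measure set T -> \bar R}) (D : set T) (f h : T -> R) (c : R) :
  measurable D -> measurable_fun D h -> (forall x, D x -> `|f x| <= h x) ->
  (\int[m]_(x in D) (h x)%:E <= c%:E)%E ->
  `|\int[m]_(x in D) f x| <= c.
Proof.
move=> mD mh fh hc.
have h0 x : D x -> 0 <= h x by move=> /fh; exact: le_trans.
rewrite ler_norml; apply/andP; split.
  apply: (Rintegral_ge_majorant mD measurable0 _ mh) => // x Dx _.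
  by move: (fh x Dx); rewrite ler_norml => /andP[].
apply: (Rintegral_le_majorant mD measurable0 _ mh) => // x Dx _.
by move: (fh x Dx); rewrite ler_norml => /andP[].
Qed.

(** * The truncated area: pointwise estimates *)

Lemma powR_le_endpoints (R : realType) (a b i c : R) :
  0 < a -> b <= i <= c -> a `^ i <= a `^ b + a `^ c.
Proof.
move=> a0 /andP[bi ic]; have [a1|a1] := leP 1 a.
  by rewrite (le_trans (ler_powR a1 ic))// lerDr powR_ge0.
have ai : a `^ i <= a `^ b by apply: ger_powR => //; rewrite a0 ltW.
by rewrite (le_trans ai)// lerDl powR_ge0.
Qed.

(** The weight is the sum of the four corner monomials of a rectangle of exponents, hence dominates
    every monomial inside it. The error estimates reduce to locating exponents in this rectangle. *)
Lemma monomial_le_weight (R : realType) (alpha mu sigma eps i j a v : R) :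
  mu <= i <= 2 -> - alpha - 1 <= j <= Num.max (1 + eps) (sigma + 2 / 3) ->
  0 < a -> 0 < v -> a `^ i * v `^ j <= weight alpha mu sigma eps a v.
Proof.
move=> hi hj a0 v0; rewrite /weight -[a ^+ 2]powR_mulrn; last exact: ltW.
by apply: ler_pM; rewrite ?powR_ge0//; exact: powR_le_endpoints.
Qed.

Lemma weight_ge0 (R : realType) (alpha mu sigma eps a v : R) :
  0 <= weight alpha mu sigma eps a v.
Proof. by rewrite mulr_ge0// addr_ge0 ?powR_ge0 ?sqr_ge0. Qed.

Section pointwise.
Variables (R : realType) (delta kappa : R).
Hypotheses (delta0 : 0 < delta).
Implicit Types x y : R * R.

Let delta2 : 0 <= 2 * delta.
Proof. by rewrite mulr_ge0// ltW. Qed.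

Definition defect x : R := x.1 + x.1^-1 + x.2 `^ kappa + x.2^-1.

Definition cutoff x : R := Num.max 0 (1 - delta * defect x).

Definition trunc_area x : R := x.1 * cutoff x ^+ 2.

(** Closed forms of the two partial derivatives, identified in [is_derive_trunc_area_a] and
    [is_derive_trunc_area_v]. Every term produced by the cutoff keeps a factor [delta] and a factor
    [cutoff]. *)
Definition trunc_area_a x : R :=
  cutoff x ^+ 2 - 2 * delta * cutoff x * (x.1 - x.1^-1).

Definition trunc_area_v x : R :=
  - (2 * delta * x.1 * cutoff x * (kappa * x.2 `^ (kappa - 1) - x.2 ^- 2)).

Lemma defect_ge0 x : phase x -> 0 <= defect x.
Proof.
by case=> a0 v0; rewrite /defect !addr_ge0 ?powR_ge0 ?invr_ge0// ltW.
Qed.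

Lemma cutoff_ge0 x : 0 <= cutoff x.
Proof. by rewrite le_max lexx. Qed.

Lemma cutoff_le1 x : phase x -> cutoff x <= 1.
Proof.
move=> /defect_ge0 x0; rewrite ge_max ler01/= gerBl.
by rewrite mulr_ge0// ltW.
Qed.

Lemma onem_cutoff_le x : 1 - cutoff x <= delta * defect x.
Proof. by rewrite lerBlDr -lerBlDl le_max lexx orbT. Qed.

Lemma defect_mul_area x : phase x ->
  x.1 * defect x = x.1 ^+ 2 + 1 + x.1 * x.2 `^ kappa + x.1 * x.2^-1.
Proof. by case=> a0 v0; rewrite /defect; field; rewrite /= !gt_eqF. Qed.

(** For 0 <= q <= 1 one has 1 - q^2 <= 2 (1 - q), and 1 - q is at most [delta * defect]. *)
Lemma trunc_area_dist x : phase x ->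
  `|trunc_area x - x.1| <= 2 * delta * (x.1 * defect x).
Proof.
case: x => a v Px; have q0 := cutoff_ge0 (a, v); have q1 := cutoff_le1 Px.
have qd := onem_cutoff_le (a, v); have [/= a0 v0] := Px.
rewrite ler0_norm /trunc_area/=; last by rewrite subr_le0 ler_piMr ?(ltW a0)// exprn_ile1.
have -> : - (a * cutoff (a, v) ^+ 2 - a) = a * (1 - cutoff (a, v) ^+ 2) by ring.
have : 1 - cutoff (a, v) ^+ 2 <= 2 * (delta * defect (a, v)) by nra.
by move=> h; rewrite (le_trans (ler_wpM2l (ltW a0) h))//; lra.
Qed.

(** The operator a d/da fixes a, so only the derivative of the cutoff contributes: the difference is
    exactly 2 delta q (1 - a^2). *)
Lemma trunc_area_a_dist x : phase x ->
  `|x.1 * trunc_area_a x - trunc_area x| <= 2 * delta * (x.1 ^+ 2 + 1).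
Proof.
case: x => a v Px; have q0 := cutoff_ge0 (a, v); have q1 := cutoff_le1 Px.
have [/= a0 v0] := Px; rewrite /=.
have -> : a * trunc_area_a (a, v) - trunc_area (a, v) =
    2 * delta * (cutoff (a, v) * (1 - a ^+ 2)).
  by rewrite /trunc_area_a /trunc_area/=; field; rewrite /= ?gt_eqF.
rewrite normrM ger0_norm ?delta2// ler_wpM2l ?delta2//.
rewrite normrM ger0_norm//.
rewrite (le_trans (ler_piMl _ q1))//.
by rewrite (le_trans (ler_normB _ _))// normr1 ger0_norm ?sqr_ge0// addrC.
Qed.

Lemma trunc_area_v_dist x : 0 < kappa < 1 -> phase x ->
  `|x.2 * trunc_area_v x| <=
    2 * delta * (x.1 * x.2 `^ kappa + x.1 * x.2^-1).
Proof.
case: x => a v /andP[k0 k1] Px; have q0 := cutoff_ge0 (a, v); have q1 := cutoff_le1 Px.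
have [/= a0 v0] := Px; rewrite /=.
have -> : v * trunc_area_v (a, v) = 2 * delta *
    (- (cutoff (a, v) * (a * (kappa * (v * v `^ (kappa - 1)) - v^-1)))).
  by rewrite /trunc_area_v/=; field; rewrite /= ?gt_eqF.
rewrite normrM ger0_norm ?delta2// ler_wpM2l ?delta2//.
rewrite normrN normrM ger0_norm//.
rewrite (le_trans (ler_piMl _ q1))// -mulrDr normrM gtr0_norm//.
rewrite ler_wpM2l ?(ltW a0)// mulr_powRB1 ?(ltW v0)//.
rewrite (le_trans (ler_normB _ _))// lerD//.
  rewrite normrM ger0_norm ?(ltW k0)// ger0_norm ?powR_ge0//.
  by rewrite ler_piMl ?powR_ge0// ltW.
by rewrite ger0_norm// invr_ge0 ltW.
Qed.

Lemma trunc_area_a_ge x : phase x -> - (2 * delta * x.1) <= trunc_area_a x.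
Proof.
case: x => a v Px; have q0 := cutoff_ge0 (a, v); have q1 := cutoff_le1 Px.
have [/= a0 v0] := Px; rewrite /trunc_area_a/=.
have ai0 : 0 < a^-1 by rewrite invr_gt0.
have : cutoff (a, v) * (a - a^-1) <= a by nra.
have d0 := delta2.
by move=> /(ler_wpM2l d0); have := sqr_ge0 (cutoff (a, v)); lra.
Qed.

Lemma trunc_area_a_le x : phase x -> trunc_area_a x <= 1 + 2 * delta * x.1^-1.
Proof.
case: x => a v Px; have q0 := cutoff_ge0 (a, v); have q1 := cutoff_le1 Px.
have [/= a0 v0] := Px; rewrite /trunc_area_a/=.
have ai0 : 0 < a^-1 by rewrite invr_gt0.
have : - a^-1 <= cutoff (a, v) * (a - a^-1) by nra.
have d0 := delta2.
move=> /(ler_wpM2l d0); have : cutoff (a, v) ^+ 2 <= 1 by exact: exprn_ile1.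
by lra.
Qed.

(** Here rho stands for r(x) and c for c0 v^(2/3). The drift lowers a, so it contributes
    nonpositively wherever the slope is nonnegative; a negative slope is at least -2 delta a. *)
Lemma trunc_drift_le x (rho rhomax c : R) : phase x ->
  0 <= rho <= rhomax -> 0 <= c <= x.1 ->
  rho * (c - x.1) * trunc_area_a x <= 2 * delta * (rhomax * x.1 ^+ 2).
Proof.
case: x => a v Px /andP[rho0 rhom] /andP[/= c0 cx]; have /= T := trunc_area_a_ge Px.
have [/= a0 v0] := Px; rewrite /=.
have d0 := delta2.
have h1 : rho * (a - c) <= rhomax * a.
  by apply: ler_pM => //; lra.
have h0 : 0 <= rho * (a - c) by apply: mulr_ge0 => //; lra.
have : rho * (a - c) * - trunc_area_a (a, v) <= rhomax * a * (2 * delta * a).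
  have p0 : 0 <= 2 * delta * a by rewrite !mulr_ge0// ltW.
  have [t0|t0] := leP 0 (- trunc_area_a (a, v)); first by apply: ler_pM => //; lra.
  by rewrite (@le_trans _ _ 0)// ?mulr_ge0_le0// ?(ltW t0)// mulr_ge0// (le_trans h0).
by move=> h; nra.
Qed.

(** With slope at most 1 + 2 delta / a, the loss exceeds the untruncated bound rhomax a only by a
    term of order delta, in which the factor a has cancelled. *)
Lemma trunc_drift_ge x (rho rhomax c : R) : phase x ->
  0 <= rho <= rhomax -> 0 <= c <= x.1 ->
  - (rhomax * x.1 + 2 * delta * rhomax) <= rho * (c - x.1) * trunc_area_a x.
Proof.
case: x => a v Px /andP[rho0 rhom] /andP[/= c0 cx]; have /= T := trunc_area_a_le Px.
have [/= a0 v0] := Px; rewrite /=.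
have d0 := delta2.
have h1 : rho * (a - c) <= rhomax * a.
  by apply: ler_pM => //; lra.
have h0 : 0 <= rho * (a - c) by apply: mulr_ge0 => //; lra.
have : rho * (a - c) * trunc_area_a (a, v) <=
    rhomax * a * (1 + 2 * delta * a^-1).
  have p0 : 0 <= 1 + 2 * delta * a^-1.
    by rewrite addr_ge0// !mulr_ge0 ?invr_ge0// ltW.
  have [t0|t0] := leP 0 (trunc_area_a (a, v)); first exact: ler_pM.
  by rewrite (@le_trans _ _ 0)// ?mulr_ge0_le0// ?(ltW t0)// mulr_ge0// (le_trans h0).
have -> : rhomax * a * (1 + 2 * delta * a^-1) = rhomax * a + 2 * delta * rhomax.
  by field; rewrite /= ?gt_eqF.
by move=> h; nra.
Qed.

(** A product bound E(x) E(y) on pairs of particles lets the double fusion integral factor into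
    single-particle moments. *)
Let envelope x := (1 + x.1 ^+ 2) * (1 + x.2 `^ kappa + x.2^-1).

Let envelope_ge1 x : phase x -> 1 <= envelope x.
Proof.
case=> a0 v0; rewrite -[leLHS]mulr1 /envelope ler_pM//.
  by rewrite lerDl sqr_ge0.
by rewrite -addrA lerDl addr_ge0 ?powR_ge0// invr_ge0 ltW.
Qed.

Let mul_defect_le x : phase x -> x.1 * defect x <= envelope x.
Proof.
case: x => a v Px; rewrite defect_mul_area//; case: Px => /= a0 v0; rewrite /envelope/=.
have := powR_ge0 v kappa; have : 0 < v^-1 by rewrite invr_gt0.
set p := v `^ _; set i := v^-1 => i0 p0.
have ap : a * p <= (1 + a ^+ 2) * p by rewrite ler_wpM2r//; nra.
have ai : a * i <= (1 + a ^+ 2) * i by rewrite ler_wpM2r//; [exact: ltW | nra].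
by rewrite !mulrDr; lra.
Qed.

Let powRD_le (v w : R) : 0 < kappa < 1 -> 0 < v -> 0 < w ->
  (v + w) `^ kappa <= 2 * (v `^ kappa + w `^ kappa).
Proof.
move=> /andP[k0 k1] v0 w0.
wlog vw : v w v0 w0 / v <= w.
  move=> H; have [vw|/ltW wv] := leP v w; first exact: H.
  by rewrite addrC [_ `^ _ + _]addrC; exact: H.
apply: (@le_trans _ _ ((2 * w) `^ kappa)).
  by apply: ge0_ler_powR; rewrite ?nnegrE; lra.
rewrite powRM ?(ltW w0)//.
have h2 : (2 : R) `^ kappa <= 2 by rewrite -[leRHS]powRr1// ler_powR//; lra.
have := powR_ge0 v kappa; have := powR_ge0 w kappa; nra.
Qed.

Let mul_defectD_le x y : 0 < kappa < 1 -> phase x -> phase y ->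
  (x.1 + y.1) * defect (x.1 + y.1, x.2 + y.2) <= 4 * (envelope x * envelope y).
Proof.
case: x => a v; case: y => b w hk [/= a0 v0] [/= b0 w0].
have Pz : @phase R (a + b, v + w) by split; rewrite /= addr_gt0.
rewrite (defect_mul_area Pz)/= /envelope.
move: (powRD_le hk v0 w0) (powR_ge0 v kappa) (powR_ge0 w kappa).
have : (v + w)^-1 <= v^-1 by rewrite lef_pV2 ?posrE//; lra.
have : 0 < w^-1 by rewrite invr_gt0.
have : 0 < v^-1 by rewrite invr_gt0.
have : 0 < (v + w)^-1 by rewrite invr_gt0 addr_gt0.
have := powR_ge0 (v + w) kappa.
move: (v + w)^-1 v^-1 w^-1 ((v + w) `^ _) (v `^ _) (w `^ _) => iz i j pz p q.
move=> pz0 iz0 i0 j0 ij pzpq p0 q0.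
have AB : 1 + a ^+ 2 + b ^+ 2 <= (1 + a ^+ 2) * (1 + b ^+ 2) by nra.
have ab2 : (a + b) ^+ 2 + 1 <= 2 * ((1 + a ^+ 2) * (1 + b ^+ 2)) by nra.
have ab1 : a + b <= 2 * ((1 + a ^+ 2) * (1 + b ^+ 2)) by nra.
have VW : 1 + pz + iz <= 2 * ((1 + p + i) * (1 + q + j)).
  have := mulr_ge0 p0 q0; have := mulr_ge0 p0 (ltW j0).
  have := mulr_ge0 (ltW i0) q0; have := mulr_ge0 (ltW i0) (ltW j0).
  by lra.
have -> : 4 * ((1 + a ^+ 2) * (1 + p + i) * ((1 + b ^+ 2) * (1 + q + j))) =
  2 * ((1 + a ^+ 2) * (1 + b ^+ 2)) * (2 * ((1 + p + i) * (1 + q + j))) by ring.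
have AB0 : 0 <= 2 * ((1 + a ^+ 2) * (1 + b ^+ 2)) by nra.
apply: le_trans (ler_wpM2l AB0 VW).
rewrite mulrDr mulrDr mulr1.
by rewrite lerD ?lerD ?ler_wpM2r// ?(ltW iz0).
Qed.

(** The area itself is additive, so only the three distances between [trunc_area] and a remain, at
    x, y and the fused particle; 12 = 2 (1 + 1 + 4). *)
Lemma trunc_area_defect_of_additivity x y : 0 < kappa < 1 -> phase x -> phase y ->
  `|trunc_area (x.1 + y.1, x.2 + y.2) - trunc_area x - trunc_area y| <=
    12 * delta * (envelope x * envelope y).
Proof.
move=> hk Px Py.
have Pz : @phase R (x.1 + y.1, x.2 + y.2).
  by case: Px Py => [a0 v0] [b0 w0]; split; rewrite /= addr_gt0.
have := trunc_area_dist Pz; have := trunc_area_dist Px; have := trunc_area_dist Py.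
have := mul_defectD_le hk Px Py; have := mul_defect_le Px; have := mul_defect_le Py.
rewrite /=; have := envelope_ge1 Px; have := envelope_ge1 Py.
move: (trunc_area _) (trunc_area _) (trunc_area _) (_ * defect _)
  (_ * defect _) (_ * defect _) (envelope _) (envelope _).
move=> fz fx fy dz dx dy E F F1 E1 dyF dxE dzEF fyy fxx fzz.
have EF : E <= E * F by nra.
have FE : F <= E * F by nra.
have : 2 * delta * (dz + dx + dy) <= 2 * delta * (6 * (E * F)).
  by rewrite ler_wpM2l//; lra.
move: fyy fxx fzz; rewrite !ler_norml => /andP[? ?] /andP[? ?] /andP[? ?].
by move=> ?; apply/andP; split; nra.
Qed.

Variables (alpha beta mu sigma : R).
Hypotheses (alpha0 : 0 < alpha) (beta01 : 0 < beta < 1) (mu0 : mu < 0)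
  (kappa01 : 0 < kappa < 1).

Let W x := weight alpha mu sigma kappa x.1 x.2.

(** The product expands into six monomials. The exponents of v are e, e + kappa and e - 1: the
    smallest possible one, -alpha - 1, is exactly the lower exponent of the weight, and the largest,
    beta + kappa, stays below 1 + kappa. *)
Let envelope_le e x : phase x -> - alpha <= e <= beta ->
  x.2 `^ e * envelope x <= 6 * W x.
Proof.
move=> [a0 v0] /andP[ae eb].
have mx : 1 + kappa <= Num.max (1 + kappa) (sigma + 2 / 3) by rewrite le_max lexx.
have H i j : mu <= i <= 2 -> - alpha - 1 <= j <= 1 + kappa ->
    x.1 `^ i * x.2 `^ j <= W x.
  by move=> hi /andP[j1 j2]; apply: monomial_le_weight => //; rewrite j1 (le_trans j2).
have -> : x.2 `^ e * envelope x =
    x.1 `^ 0 * x.2 `^ e + x.1 `^ 0 * x.2 `^ (e + kappa) +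
    x.1 `^ 0 * x.2 `^ (e - 1) + (x.1 `^ 2 * x.2 `^ e +
    x.1 `^ 2 * x.2 `^ (e + kappa) + x.1 `^ 2 * x.2 `^ (e - 1)).
  have nz : x.2 != 0 by rewrite gt_eqF.
  rewrite (@powRD _ x.2 e kappa) ?(@powRD _ x.2 e (-1)) ?nz ?implybT//.
  rewrite powR_inv1 ?(ltW v0)// powRr0 (powR_mulrn 2 (ltW a0)) /envelope.
  by ring.
move: alpha0 beta01 kappa01 mu0 => ? /andP[? ?] /andP[? ?] ?.
have := H 0 e; have := H 0 (e + kappa); have := H 0 (e - 1).
have := H 2 e; have := H 2 (e + kappa); have := H 2 (e - 1).
move=> h1 h2 h3 h4 h5 h6.
have {}h1 := h1 ltac:(lra) ltac:(lra).
have {}h2 := h2 ltac:(lra) ltac:(lra).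
have {}h3 := h3 ltac:(lra) ltac:(lra).
have {}h4 := h4 ltac:(lra) ltac:(lra).
have {}h5 := h5 ltac:(lra) ltac:(lra).
have {}h6 := h6 ltac:(lra) ltac:(lra).
lra.
Qed.

(** Each kernel summand gives one power of volume to each envelope, so two products of
    single-particle terms arise; 864 = 12 * 2 * 6^2. *)
Lemma fusion_integrand_le x y (k K0 : R) : phase x -> phase y ->
  0 <= k <= K0 * (x.2 `^ (- alpha) * y.2 `^ beta + y.2 `^ (- alpha) * x.2 `^ beta) ->
  0 < K0 ->
  `|k * (trunc_area (x.1 + y.1, x.2 + y.2) - trunc_area x - trunc_area y)| <=
    864 * delta * K0 * (W x * W y).
Proof.
move=> Px Py /andP[k0 kK] K00; rewrite normrM ger0_norm//.
have := trunc_area_defect_of_additivity kappa01 Px Py => hD.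
apply: (le_trans (ler_pM k0 (normr_ge0 _) kK hD)).
move: beta01 => /andP[b0 b1].
have ea : - alpha <= - alpha <= beta by have := alpha0; lra.
have eb : - alpha <= beta <= beta by have := alpha0; lra.
have E0 z : phase z -> 0 <= envelope z by move=> /envelope_ge1; exact: le_trans ler01.
have hxa := envelope_le Px ea; have hxb := envelope_le Px eb.
have hya := envelope_le Py ea; have hyb := envelope_le Py eb.
have pE z e : phase z -> 0 <= z.2 `^ e * envelope z.
  by move=> Pz; rewrite mulr_ge0 ?powR_ge0// E0.
have h1 := ler_pM (pE _ _ Px) (pE _ _ Py) hxa hyb.
have h2 := ler_pM (pE _ _ Py) (pE _ _ Px) hya hxb.
have -> : K0 * (x.2 `^ (- alpha) * y.2 `^ beta + y.2 `^ (- alpha) * x.2 `^ beta) *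
    (12 * delta * (envelope x * envelope y)) =
  12 * delta * K0 * (x.2 `^ (- alpha) * envelope x * (y.2 `^ beta * envelope y) +
    y.2 `^ (- alpha) * envelope y * (x.2 `^ beta * envelope x)) by ring.
have -> : 864 * delta * K0 * (W x * W y) =
  12 * delta * K0 * (6 * W x * (6 * W y) + 6 * W y * (6 * W x)) by ring.
by rewrite ler_wpM2l ?lerD// !mulr_ge0// ltW.
Qed.

End pointwise.

(** * Test curves with separated variables *)

(** A quadratic remainder bound treats the kink of the positive part on the same footing as all
    other points. *)
Lemma is_derive1_quadratic (R : realType) (f : R -> R) (x l C : R) :
  (forall h, `|f (x + h) - f x - l * h| <= C * h ^+ 2) -> is_derive x 1 f l.
Proof.
move=> H.
have C0 : 0 <= C by have := H 1; rewrite expr1n !mulr1 => /(le_trans (normr_ge0 _)).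
have L : (fun h : R => h^-1 *: (f (h *: 1 + x) - f x)) @ 0^' --> l.
  apply/cvgrPdist_le => e e0; near=> h.
  have h0 : h != 0 by near: h; exact: nbhs_dnbhs_neq.
  rewrite distrC /GRing.scale/= mulr1 (addrC h x).
  have -> : h^-1 * (f (x + h) - f x) - l = h^-1 * (f (x + h) - f x - l * h).
    by field.
  rewrite normrM normfV ler_pdivrMl ?normr_gt0//.
  apply: (le_trans (H h)); rewrite -[h ^+ 2]ger0_norm ?sqr_ge0// normrX expr2.
  rewrite mulrA mulrC ler_wpM2l ?normr_ge0//.
  have : `|h| <= e / (C + 1).
    near: h; apply: dnbhs0_le; rewrite divr_gt0//; lra.
  move=> he; apply: le_trans (ler_wpM2l C0 he) _.
  by rewrite mulrA ler_pdivrMr; nra.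
apply: DeriveDef; first by apply/cvg_ex; exists l.
exact: cvg_lim.
Unshelve. all: by end_near. Qed.

Definition pos2 {R : realType} (x : R) : R := Num.max 0 x ^+ 2.

Lemma is_derive_pos2 (R : realType) (x : R) :
  is_derive x 1 (@pos2 R) (2 * Num.max 0 x).
Proof.
apply: (@is_derive1_quadratic _ _ _ _ 1) => h; rewrite mul1r /pos2.
have [x0|x0] := leP 0 x; have [xh|xh] := leP 0 (x + h);
  by rewrite ler_norml; apply/andP; split; nra.
Qed.

Lemma continuous_max0 (R : realType) : continuous (fun x : R => Num.max 0 x).
Proof.
move=> x; apply: (@continuous_max R R (cst 0) id x); last exact: cvg_id.
exact: cst_continuous.
Qed.

Section time_cutoff.
Variables (R : realType) (t : R).

(** The rate 1/3 = 1 - 2/3 is the net growth rate of area from the linear terms. The inner [pos2]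
    leaves the exponential untouched for s <= t; the outer one switches it off in a C^1 way before t
    + 1, which gives compact support in time. *)
Definition decay (s : R) : R := expR (- (s / 3)) * pos2 (1 - pos2 (s - t)).

Definition decay' (s : R) : R :=
  - (3^-1 * decay s) - expR (- (s / 3)) *
    (2 * Num.max 0 (1 - pos2 (s - t)) * (2 * Num.max 0 (s - t))).

Lemma is_derive_decay (s : R) : is_derive s 1 decay (decay' s).
Proof.
have h1 : is_derive s 1 (fun s => - (s / 3) : R) (- 3^-1 : R).
  apply: is_derive_eq; rewrite /GRing.scale/=; lra.
have h2 := @is_derive1_comp _ expR (fun s => - (s / 3) : R) s _ _ (is_derive_expR _) h1.
have h3 : is_derive s 1 (fun s => s - t) (1 : R).
  by apply: is_derive_eq; rewrite subr0.
have h4 := @is_derive1_comp _ pos2 (fun s => s - t) s _ _ (is_derive_pos2 _) h3.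
have h5 : is_derive s 1 (fun s => 1 - pos2 (s - t)) (- (2 * Num.max 0 (s - t))).
  apply: (@is_derive_eq _ _ _ _ _ _ _ _ (is_deriveB (is_derive_cst (1 : R) s 1) h4)).
  by rewrite sub0r mulr1.
have h6 := @is_derive1_comp _ pos2 (fun s => 1 - pos2 (s - t)) s _ _ (is_derive_pos2 _) h5.
have := is_deriveM h2 h6.
move=> h; apply: (@is_derive_eq _ _ _ _ _ _ _ _ h).
rewrite /GRing.scale/= /decay' /decay; ring.
Qed.

Lemma decay_continuous : continuous decay.
Proof.
move=> s; apply: differentiable_continuous; apply/derivable1_diffP.
exact: (@ex_derive _ _ _ _ _ _ _ (is_derive_decay s)).
Qed.

Lemma decay'_continuous : continuous decay'.
Proof.
have cP x : {for x, continuous (@pos2 R)}.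
  apply: differentiable_continuous; apply/derivable1_diffP.
  exact: (@ex_derive _ _ _ _ _ _ _ (is_derive_pos2 x)).
move=> s; rewrite /decay'; apply: cvgB.
  by apply: cvgN; apply: cvgM; [exact: cvg_cst | exact: decay_continuous].
have cst_ : s0 - t @[s0 --> s] --> s - t by apply: cvgB; [exact: cvg_id|exact: cvg_cst].
apply: cvgM.
  apply: (@continuous_comp _ _ _ (fun s : R => - (s / 3)) expR);
    last exact: continuous_expR.
  by apply: cvgN; apply: cvgM; [exact: cvg_id|exact: cvg_cst].
apply: cvgM; apply: cvgM; try exact: cvg_cst.
  apply: (@continuous_comp _ _ _ (fun s : R => 1 - pos2 (s - t)) (Num.max 0));
    last exact: continuous_max0.
  apply: cvgB; first exact: cvg_cst.
  by apply: (@continuous_comp _ _ _ (fun s : R => s - t) pos2); last exact: cP.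
by apply: (@continuous_comp _ _ _ (fun s : R => s - t) (Num.max 0));
  last exact: continuous_max0.
Qed.

Lemma decay_eq0 (s : R) : t + 1 < s -> decay s = 0.
Proof.
move=> ts; rewrite /decay /pos2 [Num.max 0 (s - t)]max_r; last lra.
by rewrite max_l ?expr0n/= ?mulr0//; nra.
Qed.

Lemma decayE (s : R) : s <= t -> decay s = expR (- (s / 3)).
Proof.
move=> st; rewrite /decay /pos2 [Num.max 0 (s - t)]max_l; last lra.
by rewrite expr0n/= subr0 max_r// expr1n mulr1.
Qed.

Lemma decay'E (s : R) : s <= t -> decay' s = - (3^-1 * decay s).
Proof.
move=> st; rewrite /decay' [Num.max 0 (s - t)]max_l; last lra.
by rewrite !mulr0 subr0.
Qed.

End time_cutoff.

Section tensor_test_curve.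
Variable R : realType.
Implicit Types (f : R * R -> R) (x : R * R).

Lemma open_phase : open (@phase R).
Proof.
rewrite openE => x [a0 v0]; exists ([set a | 0 < a], [set v | 0 < v]) => //=.
by split; [exact: lt_nbhsr | exact: lt_nbhsr].
Qed.

Lemma near_phase_a x : phase x -> \forall a \near x.1, @phase R (a, x.2).
Proof.
by move=> [a0 v0]; near=> a; split => //=; near: a; exact: lt_nbhsr.
Unshelve. all: by end_near. Qed.

Lemma near_phase_v x : phase x -> \forall v \near x.2, @phase R (x.1, v).
Proof.
by move=> [a0 v0]; near=> a; split => //=; near: a; exact: lt_nbhsr.
Unshelve. all: by end_near. Qed.

Lemma near_eq_continuous (T U : topologicalType) (f g : T -> U) (x : T) :
  (\forall y \near x, g y = f y) -> {for x, continuous f} -> {for x, continuous g}.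
Proof.
move=> fg cf; rewrite /prop_for /continuous_at (nbhs_singleton fg).
apply: cvg_trans cf; apply: near_eq_cvg; near do apply/esym => //.
Unshelve. all: by end_near. Qed.

Lemma d_aZ f (c : R) x : class_C1 f -> phase x ->
  d_a (fun y => c * f y) x = c * d_a f x.
Proof.
move=> Cf Px; rewrite /d_a !derive1E.
rewrite (_ : (fun a => _) = c \*: (fun a => f (a, x.2))) ?deriveZ//.
exact: class_C1_derivable_a.
Qed.

Lemma d_vZ f (c : R) x : class_C1 f -> phase x ->
  d_v (fun y => c * f y) x = c * d_v f x.
Proof.
move=> Cf Px; rewrite /d_v !derive1E.
rewrite (_ : (fun v => _) = c \*: (fun v => f (x.1, v))) ?deriveZ//.
exact: class_C1_derivable_v.
Qed.

Lemma class_C1Z f (c : R) : class_C1 f -> class_C1 (fun x => c * f x).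
Proof.
move=> Cf; split => x Px.
- by apply: derivableZ; exact: class_C1_derivable_a.
- by apply: derivableZ; exact: class_C1_derivable_v.
- by apply: cvgM; [exact: cvg_cst|exact: class_C1_continuous].
- apply: (@near_eq_continuous _ _ (fun y => c * d_a f y)).
    by have := open_phase Px; apply: filterS => y Py; exact: d_aZ.
  by apply: cvgM; [exact: cvg_cst|exact: class_C1_continuous_a].
- apply: (@near_eq_continuous _ _ (fun y => c * d_v f y)).
    by have := open_phase Px; apply: filterS => y Py; exact: d_vZ.
  by apply: cvgM; [exact: cvg_cst|exact: class_C1_continuous_v].
Qed.

Lemma bounded_on_compact (A : set (R * R)) f : compact A ->
  (forall x, A x -> {for x, continuous f}) ->
  exists M : R, forall x, A x -> `|f x| <= M.
Proof.
move=> cA cf.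
have /compact_bounded[M [_ HM]] : compact (f @` A).
  apply: continuous_compact => //; apply: continuous_in_subspaceT => x.
  by rewrite inE; exact: cf.
exists (M + 1) => x Ax; apply: (HM (M + 1)); first by rewrite ltrDl.
by exists x.
Qed.

(** The complement of A is open, so f vanishes at all points near x on the line along which a
    varies. *)
Lemma d_a_support f (A : set (R * R)) x : closed A ->
  (forall y, phase y -> ~ A y -> f y = 0) -> phase x -> ~ A x -> d_a f x = 0.
Proof.
move=> clA f0 Px nAx; rewrite /d_a derive1E.
have nA : \forall y \near x, ~ A y.
  by apply: open_nbhs_nbhs; split => //; exact: closed_openC.
rewrite (@near_eq_derive _ _ _ _ (cst 0)) ?derive_cst//.
have : \forall a \near x.1, ~ A (a, x.2).
  have : (a, x.2) @[a --> x.1] --> x.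
    rewrite [X in _ --> X]surjective_pairing.
    apply: (@cvg_pair _ _ _ (nbhs x.1) (nbhs x.1) (nbhs x.2)); first exact: cvg_id.
    exact: cvg_cst.
  by move=> /(_ _ nA).
have := near_phase_a Px; apply: filterS2 => a Pa nAa; exact: f0.
Qed.

Lemma d_v_support f (A : set (R * R)) x : closed A ->
  (forall y, phase y -> ~ A y -> f y = 0) -> phase x -> ~ A x -> d_v f x = 0.
Proof.
move=> clA f0 Px nAx; rewrite /d_v derive1E.
have nA : \forall y \near x, ~ A y.
  by apply: open_nbhs_nbhs; split => //; exact: closed_openC.
rewrite (@near_eq_derive _ _ _ _ (cst 0)) ?derive_cst//.
have : \forall a \near x.2, ~ A (x.1, a).
  have : (x.1, a) @[a --> x.2] --> x.
    rewrite [X in _ --> X]surjective_pairing.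
    apply: (@cvg_pair _ _ _ (nbhs x.2) (nbhs x.1) (nbhs x.2)); last exact: cvg_id.
    exact: cvg_cst.
  by move=> /(_ _ nA).
have := near_phase_v Px; apply: filterS2 => a Pa nAa; exact: f0.
Qed.

Lemma class_C1_bounded f : class_C1 f -> compact_support f ->
  exists2 M : R, 0 < M &
    forall x, phase x -> [/\ `|f x| <= M, `|d_a f x| <= M & `|d_v f x| <= M].
Proof.
move=> Cf [A [cA AP f0]].
have clA : closed A by apply: compact_closed cA; exact: (@norm_hausdorff R (R * R)%type).
have [M0 H0] := bounded_on_compact cA (fun x Ax => class_C1_continuous Cf (AP x Ax)).
have [M1 H1] := bounded_on_compact cA (fun x Ax => class_C1_continuous_a Cf (AP x Ax)).
have [M2 H2] := bounded_on_compact cA (fun x Ax => class_C1_continuous_v Cf (AP x Ax)).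
exists (1 + `|M0| + `|M1| + `|M2|) => [|x Px].
  by rewrite !ltr_wpDr.
have n0 := normr_ge0 M0; have n1 := normr_ge0 M1; have n2 := normr_ge0 M2.
have l0 := ler_norm M0; have l1 := ler_norm M1; have l2 := ler_norm M2.
have [Ax|nAx] := pselect (A x).
  have := H0 _ Ax; have := H1 _ Ax; have := H2 _ Ax.
  by move: (f x) (d_a f x) (d_v f x) => p q r *; split; lra.
rewrite f0// (d_a_support clA f0)// (d_v_support clA f0)// normr0.
by split; lra.
Qed.

(** Difference quotients act on the time factor alone. With a uniform C^1 bound M on f, scalar
    convergence within e / M becomes C^1 closeness within e. *)
Lemma test_curve_tensor (theta dtheta : R -> R) (T : R) f :
  class_C1 f -> compact_support f ->
  (forall s : R, is_derive s 1 theta (dtheta s)) -> continuous dtheta ->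
  (forall s, T < s -> theta s = 0) ->
  test_curve (fun s x => theta s * f x) (fun s x => dtheta s * f x).
Proof.
move=> Cf supf dth cdth th0.
have [M M0 HM] := class_C1_bounded Cf supf.
have close (e c d : R) : `|c - d| <= e / M ->
    C1_close e (fun x => c * f x) (fun x => d * f x).
  move=> cd x Px; rewrite !d_aZ// !d_vZ// -!mulrBl !normrM.
  have [h0 h1 h2] := HM _ Px.
  have e_ : e = e / M * M by field; rewrite gt_eqF.
  by split; rewrite [leRHS]e_ ler_pM.
split.
- have [A [cA AP f0]] := supf; exists T, A; split => // t x t0 Px fx.
  split.
    by rewrite leNgt; apply/negP => /th0 h; rewrite h mul0r eqxx in fx.
  by apply: contrapT => /(f0 _ Px) h; rewrite h mulr0 eqxx in fx.
- by move=> t _; exact: class_C1Z.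
- by move=> t _; exact: class_C1Z.
- move=> t e t0 e0.
  have /cvgrPdist_le/(_ (e / M)) :
      (fun h => h^-1 *: (theta (h *: 1 + t) - theta t)) @ 0^' --> dtheta t.
    by have [H <-] := dth t; exact: H.
  move=> /(_ ltac:(by rewrite divr_gt0)); apply: filterS => h H _.
  rewrite (_ : (fun x => _) = (fun x => h^-1 * (theta (t + h) - theta t) * f x)); last first.
    by apply/funext => x; ring.
  by apply: close; rewrite distrC; move: H; rewrite /GRing.scale/= mulr1 (addrC h t).
- move=> t e t0 e0.
  have /cvgrPdist_le/(_ (e / M)) := cdth t.
  move=> /(_ ltac:(by rewrite divr_gt0)); apply: filterS => s H _.
  by apply: close; rewrite distrC.
Qed.

End tensor_test_curve.

(** * The truncated area: regularity *)

Section trunc_area_regularity.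
Variables (R : realType) (delta kappa : R).
Hypotheses (delta0 : 0 < delta) (kappa0 : 0 < kappa).
Implicit Types x : R * R.

Local Notation f := (trunc_area delta kappa).
Local Notation fa := (trunc_area_a delta kappa).
Local Notation fv := (trunc_area_v delta kappa).

Lemma is_derive_trunc_area_a x : phase x ->
  is_derive x.1 1 (fun a => f (a, x.2)) (fa x).
Proof.
case: x => a v [/= a0 v0].
have hV := @is_deriveV _ id a _ 1 (lt0r_neq0 a0) (is_derive_id a 1).
have h1 := is_deriveD (is_deriveD (is_deriveD (is_derive_id a (1 : R)) hV)
  (is_derive_cst (v `^ kappa) a 1)) (is_derive_cst v^-1 a 1).
have h2 := is_deriveB (is_derive_cst (1 : R) a 1) (is_deriveZ delta h1).
have h3 := @is_derive1_comp _ pos2 _ a _ _ (is_derive_pos2 _) h2.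
have h4 := is_deriveM (is_derive_id a (1 : R)) h3.
apply: (@is_derive_eq _ _ _ _ _ _ _ _ h4).
rewrite /trunc_area_a /cutoff /defect /GRing.scale/= /pos2.
rewrite /cst/= !fctE/= /GRing.scale/=.
set q := Num.max 0 _.
by field; rewrite gt_eqF.
Qed.

Lemma is_derive_trunc_area_v x : phase x ->
  is_derive x.2 1 (fun v => f (x.1, v)) (fv x).
Proof.
case: x => a v [/= a0 v0].
have hV := @is_deriveV _ id v _ 1 (lt0r_neq0 v0) (is_derive_id v 1).
have h1 := is_deriveD (is_deriveD (is_deriveD (is_derive_cst a v (1 : R))
  (is_derive_cst a^-1 v 1)) (is_derive1_powR kappa v0)) hV.
have h2 := is_deriveB (is_derive_cst (1 : R) v 1) (is_deriveZ delta h1).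
have h3 := @is_derive1_comp _ pos2 _ v _ _ (is_derive_pos2 _) h2.
have h4 := is_deriveM (is_derive_cst a v (1 : R)) h3.
apply: (@is_derive_eq _ _ _ _ _ _ _ _ h4).
rewrite /trunc_area_v /cutoff /defect /GRing.scale/= /pos2.
rewrite /cst/= !fctE/= /GRing.scale/=.
set q := Num.max 0 _; set p := v `^ (kappa - 1).
by field; rewrite gt_eqF.
Qed.

Lemma d_a_trunc_area x : phase x -> d_a f x = fa x.
Proof.
by move=> Px; rewrite /d_a derive1E; have [_ ->] := is_derive_trunc_area_a Px.
Qed.

Lemma d_v_trunc_area x : phase x -> d_v f x = fv x.
Proof.
by move=> Px; rewrite /d_v derive1E; have [_ ->] := is_derive_trunc_area_v Px.
Qed.

Lemma powR_snd_continuous_at (p : R) x : phase x ->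
  {for x, continuous (fun y : R * R => y.2 `^ p)}.
Proof.
move=> [_ v0]; apply: (@continuous_comp (R * R)%type R R (fun y => y.2) (fun u => u `^ p) x).
  exact: cvg_snd.
apply: differentiable_continuous; apply/derivable1_diffP.
exact: (@ex_derive _ _ _ _ _ _ _ (is_derive1_powR p v0)).
Qed.

Lemma cutoff_continuous_at x :
  phase x -> {for x, continuous (cutoff delta kappa)}.
Proof.
move=> Px; have [a0 v0] := Px.
apply: (@continuous_comp (R * R)%type R R (fun y => 1 - delta * defect kappa y)
  (Num.max 0) x); last exact: continuous_max0.
apply: cvgB; first exact: cvg_cst.
apply: cvgM; first exact: cvg_cst.
apply: cvgD; last by apply: cvgV; [rewrite gt_eqF|exact: cvg_snd].
apply: cvgD; last exact: powR_snd_continuous_at.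
by apply: cvgD; [exact: cvg_fst|apply: cvgV; [rewrite gt_eqF|exact: cvg_fst]].
Qed.

Lemma trunc_area_continuous_at x : phase x -> {for x, continuous f}.
Proof.
move=> Px; apply: cvgM; first exact: cvg_fst.
by apply: cvgM; exact: cutoff_continuous_at.
Qed.

Lemma trunc_area_a_continuous_at x : phase x -> {for x, continuous fa}.
Proof.
move=> Px; have [a0 v0] := Px; apply: cvgB.
  by apply: cvgM; exact: cutoff_continuous_at.
apply: cvgM; first by apply: cvgM; [exact: cvg_cst|exact: cutoff_continuous_at].
by apply: cvgB; [exact: cvg_fst|apply: cvgV; [rewrite gt_eqF|exact: cvg_fst]].
Qed.

Lemma trunc_area_v_continuous_at x : phase x -> {for x, continuous fv}.
Proof.
move=> Px; have [a0 v0] := Px; apply: cvgN; apply: cvgM.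
  apply: cvgM; last exact: cutoff_continuous_at.
  by apply: cvgM; [exact: cvg_cst|exact: cvg_fst].
apply: cvgB.
  by apply: cvgM; [exact: cvg_cst|exact: powR_snd_continuous_at].
by apply: cvgV; [rewrite expf_neq0// gt_eqF|apply: cvgM; exact: cvg_snd].
Qed.

Lemma class_C1_trunc_area : class_C1 f.
Proof.
split => x Px.
- by have [] := is_derive_trunc_area_a Px.
- by have [] := is_derive_trunc_area_v Px.
- exact: trunc_area_continuous_at.
- apply: (@near_eq_continuous _ _ fa); last exact: trunc_area_a_continuous_at.
  by have := open_phase Px; apply: filterS => y Py; exact: d_a_trunc_area.
- apply: (@near_eq_continuous _ _ fv); last exact: trunc_area_v_continuous_at.
  by have := open_phase Px; apply: filterS => y Py; exact: d_v_trunc_area.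
Qed.

Lemma cutoff_support : exists A : set (R * R),
  [/\ compact A, A `<=` phase & forall x, phase x -> ~ A x -> cutoff delta kappa x = 0].
Proof.
(* Where the cutoff is positive, all four terms of [defect] are below 1 / delta: the first two
   confine a, the term 1/v bounds v from below, and v^kappa bounds it from above. *)
exists (`[delta, delta^-1] `*` `[delta, delta^-1 `^ kappa^-1])%classic; split.
- by apply: compact_setX; exact: segment_compact.
- move=> [a v] [/=]; rewrite !in_itv/= => /andP[da _] /andP[dv _].
  by have := delta0; split => /=; lra.
- move=> [a v] [/= a0 v0] nA; apply: max_l; rewrite leNgt; apply/negP => q0.
  apply: nA.
  have p0 := powR_ge0 v kappa; have ai0 : 0 < a^-1 by rewrite invr_gt0.
  have vi0 : 0 < v^-1 by rewrite invr_gt0.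
  have lt1 u : 0 < u -> delta * u < 1 -> u <= delta^-1.
    by move=> u0 h; rewrite -[delta^-1]mul1r ler_pdivlMr// mulrC ltW.
  have lt2 u : 0 < u -> delta * u^-1 < 1 -> delta <= u.
    by move=> u0 h; rewrite ltW// -[u]mul1r -ltr_pdivrMr.
  have d := delta0.
  have := mulr_ge0 (ltW d) p0; have := mulr_gt0 d ai0; have := mulr_gt0 d vi0.
  have := mulr_gt0 d a0 => da dvi dai dp.
  move: q0; rewrite /defect/= !mulrDr => q0.
  have h1 : a <= delta^-1 by apply: lt1 => //; lra.
  have h2 : delta <= a by apply: lt2 => //; lra.
  have h3 : delta <= v by apply: lt2 => //; lra.
  have h4 : v `^ kappa <= delta^-1 by apply: lt1; [exact: powR_gt0|lra].
  split; rewrite /= in_itv/= ?h1 ?h2 ?h3//=.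
  have -> : v = (v `^ kappa) `^ kappa^-1 by rewrite -powRrM divff ?gt_eqF// powRr1// ltW.
  by apply: ge0_ler_powR => //; rewrite ?invr_ge0 ?nnegrE ?powR_ge0 ?invr_ge0// ltW.
Qed.

Lemma compact_support_trunc_area : compact_support f.
Proof.
have [A [cA AP q0]] := cutoff_support; exists A; split => // x Px nA.
by rewrite /trunc_area q0// expr0n mulr0.
Qed.

Lemma Cc_trunc_area : Cc f.
Proof.
by split; [exact: trunc_area_continuous_at|exact: compact_support_trunc_area].
Qed.

(** Membership in [Cc] makes the integral continuous in time, hence time-integrable. This is wanted
    for f and a f_a, whose time integrals are recombined by linearity. *)
Lemma Cc_mul_trunc_area_a : Cc (fun x => x.1 * fa x).
Proof.
split => [x Px|].
  by apply: cvgM; [exact: cvg_fst|exact: trunc_area_a_continuous_at].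
have [A [cA AP q0]] := cutoff_support; exists A; split => // x Px nA.
by rewrite /trunc_area_a q0// expr0n mulr0 mul0r subr0 mulr0.
Qed.

End trunc_area_regularity.

(** * Moment estimates *)

Lemma measurable_phase (R : realType) : measurable (@phase R).
Proof.
have -> : @phase R = `]0, +oo[%classic `*` `]0, +oo[%classic.
  by apply/seteqP; split => -[a v] /=; rewrite !in_itv/= !andbT.
by apply: measurableX; exact: measurable_itv.
Qed.

Lemma measurable_powR_fst (R : realType) (p : R) :
  measurable_fun [set: R * R] (fun x => x.1 `^ p).
Proof. exact: measurableT_comp (measurable_powR p) measurable_fst. Qed.

Lemma measurable_powR_snd (R : realType) (p : R) :
  measurable_fun [set: R * R] (fun x => x.2 `^ p).
Proof. exact: measurableT_comp (measurable_powR p) measurable_snd. Qed.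

Lemma measurable_weight (R : realType) (alpha mu sigma eps : R) :
  measurable_fun [set: R * R] (fun x => weight alpha mu sigma eps x.1 x.2).
Proof.
apply: measurable_funM; apply: measurable_funD.
- exact: measurable_powR_fst.
- by apply: measurable_funM; exact: measurable_fst.
- exact: measurable_powR_snd.
- exact: measurable_powR_snd.
Qed.

Lemma c0_gt0 (R : realType) : 0 < @c0 R.
Proof. by rewrite powR_gt0// mulr_gt0// pi_gt0. Qed.

Lemma measurable_nonisoperimetric (R : realType) :
  measurable [set x : R * R | phase x /\ x.1 < c0 * x.2 `^ (2 / 3)].
Proof.
have mlt : measurable_fun (@phase R) (fun x => x.1 < c0 * x.2 `^ (2 / 3)).
  apply: measurable_fun_ltr; first exact: measurable_funTS measurable_fst.
  by apply: measurable_funM => //; apply: measurable_funTS; exact: measurable_powR_snd.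
have := mlt (@measurable_phase R) [set true] ltac:(by []).
by congr (measurable _).
Qed.

Lemma measurable_cutoff (R : realType) (delta kappa : R) :
  measurable_fun (@phase R) (cutoff delta kappa).
Proof.
apply: measurable_maxr; first exact: measurable_cst.
apply: measurable_funB; first exact: measurable_cst.
apply: measurable_funM; first exact: measurable_cst.
apply: (@eq_measurable_fun _ _ _ _ _
  (fun x : R * R => x.1 + x.1 `^ (-1) + x.2 `^ kappa + x.2 `^ (-1))).
  by move=> x; rewrite inE => -[a0 v0]; rewrite !powR_inv1// ltW.
apply: measurable_funTS.
apply: measurable_funD; last exact: measurable_powR_snd.
apply: measurable_funD; last exact: measurable_powR_snd.
apply: measurable_funD; last exact: measurable_powR_fst.
exact: measurable_fst.
Qed.

Lemma measurable_trunc_area (R : realType) (delta kappa : R) :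
  measurable_fun (@phase R) (trunc_area delta kappa).
Proof.
apply: measurable_funM; first exact: measurable_funTS measurable_fst.
by apply: measurable_funM; exact: measurable_cutoff.
Qed.

Lemma measurable_trunc_area_a (R : realType) (delta kappa : R) :
  measurable_fun (@phase R) (trunc_area_a delta kappa).
Proof.
apply: measurable_funB.
  by apply: measurable_funM; exact: measurable_cutoff.
apply: measurable_funM.
  by apply: measurable_funM; [exact: measurable_cst|exact: measurable_cutoff].
apply: (@eq_measurable_fun _ _ _ _ _ (fun x : R * R => x.1 - x.1 `^ (-1))).
  by move=> x; rewrite inE => -[a0 v0]; rewrite powR_inv1// ltW.
apply: measurable_funTS; apply: measurable_funB; last exact: measurable_powR_fst.
exact: measurable_fst.
Qed.

Section moments.
Variables (R : realType) (alpha mu sigma eps delta b : R) (m : plane_measure R).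
Hypotheses (alpha0 : 0 < alpha) (mu0 : mu < 0) (eps01 : 0 < eps < 1)
  (delta0 : 0 < delta).
Let W (x : R * R) := weight alpha mu sigma eps x.1 x.2.
Hypothesis mW : (moment m (weight alpha mu sigma eps) <= b%:E)%E.
Local Notation f := (trunc_area delta eps).
Local Notation fa := (trunc_area_a delta eps).

Lemma weight_bound_ge0 : 0 <= b.
Proof.
rewrite -lee_fin (le_trans _ mW)// integral_ge0// => x _.
by rewrite lee_fin weight_ge0.
Qed.

Lemma measurable_scaled_weight c : measurable_fun phase (fun x => c * W x).
Proof.
apply: measurable_funM; first exact: measurable_cst.
exact: measurable_funTS (measurable_weight _ _ _ _).
Qed.

Lemma integral_weightZ c : 0 <= c ->
  (\int[m]_(x in phase) (c * W x)%:E <= (c * b)%:E)%E.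
Proof.
move=> c0; apply: (ge0_integralZl_le (@measurable_phase R) _ c0 _ mW).
  exact: measurable_funTS (measurable_weight _ _ _ _).
by move=> x _; exact: weight_ge0.
Qed.

Lemma integrable_le_weight (h : R * R -> R) c : 0 <= c ->
  measurable_fun phase h -> (forall x, phase x -> `|h x| <= c * W x) ->
  m.-integrable phase (EFin \o h).
Proof.
move=> c0 mh hc; apply/integrableP; split; first exact/measurable_EFinP.
apply: le_lt_trans (ltry (c * b)).
apply: le_trans (integral_weightZ c0).
by apply: ge0_le_integral_nomeas => x Px; rewrite ?lee_fin ?hc// normr_ge0.
Qed.

Lemma monomial_le_weight_eps x i j : phase x -> mu <= i <= 2 ->
  - alpha - 1 <= j <= 1 + eps -> x.1 `^ i * x.2 `^ j <= W x.
Proof.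
move=> [a0 v0] hi /andP[j1 j2]; apply: monomial_le_weight => //.
by rewrite j1 le_max j2.
Qed.

(** Besides a itself, these are the monomials of [defect_mul_area] and of the derivative
    estimates. *)
Lemma monomials_le_weight x : phase x ->
  [/\ x.1 <= W x, x.1 ^+ 2 <= W x, 1 <= W x,
      x.1 * x.2 `^ eps <= W x & x.1 * x.2^-1 <= W x].
Proof.
move=> Px; have [a0 v0] := Px; have e01 := eps01; have al0 := alpha0; have m0 := mu0.
have H0 : - alpha - 1 <= 0 <= 1 + eps by lra.
have h1 := @monomial_le_weight_eps x 1 0 Px ltac:(lra) H0.
have h2 := @monomial_le_weight_eps x 2 0 Px ltac:(lra) H0.
have h3 := @monomial_le_weight_eps x 0 0 Px ltac:(lra) H0.
have h4 := @monomial_le_weight_eps x 1 eps Px ltac:(lra) ltac:(lra).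
have h5 := @monomial_le_weight_eps x 1 (-1) Px ltac:(lra) ltac:(lra).
move: h1 h2 h3 h4 h5; rewrite !powRr0 !mulr1 powRr1 ?(ltW a0)//.
by rewrite (powR_mulrn 2 (ltW a0)) powR_inv1 ?(ltW v0).
Qed.

Lemma integrable_area : m.-integrable phase (EFin \o (fun x : R * R => x.1)).
Proof.
apply: (@integrable_le_weight _ 1) => //; first exact: measurable_funTS measurable_fst.
move=> x Px; have [h _ _ _ _] := monomials_le_weight Px; case: Px => a0 _.
by rewrite mul1r ger0_norm// ltW.
Qed.

(** The area is finite, so [fine] loses nothing and real-valued integrals can be used for M(t). *)
Lemma moment_area : moment m (fun a _ => a) = (\int[m]_(x in phase) x.1)%:E.
Proof.
rewrite /moment fineK//; apply: integrable_fin_num integrable_area.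
exact: measurable_phase.
Qed.

Lemma trunc_area_ge0_le x : phase x -> 0 <= f x <= x.1.
Proof.
move=> Px; have q0 := cutoff_ge0 delta eps x; have q1 := cutoff_le1 eps delta0 Px.
have [a0 _] := Px; rewrite /trunc_area mulr_ge0 ?sqr_ge0 ?(ltW a0)//=.
by rewrite ler_piMr ?(ltW a0)// exprn_ile1.
Qed.

Lemma integrable_trunc_area : m.-integrable phase (EFin \o f).
Proof.
apply: (@integrable_le_weight _ 1) => //; first exact: measurable_trunc_area.
move=> x Px; have [h _ _ _ _] := monomials_le_weight Px.
have /andP[h0 h1] := trunc_area_ge0_le Px.
by rewrite mul1r ger0_norm// (le_trans h1).
Qed.

Lemma integrable_mul_trunc_area_a : m.-integrable phase (EFin \o (fun x => x.1 * fa x)).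
Proof.
have d0 := delta0.
have c0 : 0 <= 4 * delta + 1 by lra.
apply: (integrable_le_weight c0).
  apply: measurable_funM; first exact: measurable_funTS measurable_fst.
  exact: measurable_trunc_area_a.
move=> x Px; have [h h2 h1 _ _] := monomials_le_weight Px.
have /andP[f0 fle] := trunc_area_ge0_le Px.
have := trunc_area_a_dist eps delta0 Px.
move: (x.1 * fa x) (f x) (W x) (x.1) h h2 h1 f0 fle => p q w a h h2 h1 f0 fle.
have : 2 * delta * (a ^+ 2 + 1) <= 2 * delta * (2 * w) by rewrite ler_wpM2l; lra.
rewrite !ler_norml => hh /andP[? ?]; apply/andP; split; lra.
Qed.

Lemma trunc_area_integral_dist :
  `|\int[m]_(x in phase) f x - \int[m]_(x in phase) x.1| <= 8 * delta * b.
Proof.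
have d0 := delta0.
rewrite -RintegralB; first last.
- exact: integrable_area.
- exact: integrable_trunc_area.
- exact: measurable_phase.
apply: (normr_Rintegral_le_majorant _ (measurable_scaled_weight (8 * delta))).
- exact: measurable_phase.
- move=> x Px; apply: (le_trans (trunc_area_dist eps delta0 Px)).
  rewrite (defect_mul_area _ Px).
  have [_ h2 h1 h3 h4] := monomials_le_weight Px.
  rewrite (_ : 8 * delta * W x = 2 * delta * (4 * W x)); last by ring.
  by apply: ler_wpM2l; lra.
- by apply: integral_weightZ; lra.
Qed.

Lemma trunc_area_a_integral_dist :
  `|\int[m]_(x in phase) f x - \int[m]_(x in phase) (x.1 * fa x)| <= 4 * delta * b.
Proof.
have d0 := delta0.
rewrite -RintegralB; first last.
- exact: integrable_mul_trunc_area_a.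
- exact: integrable_trunc_area.
- exact: measurable_phase.
apply: (normr_Rintegral_le_majorant _ (measurable_scaled_weight (4 * delta))).
- exact: measurable_phase.
- move=> x Px; rewrite distrC; apply: (le_trans (trunc_area_a_dist eps delta0 Px)).
  have [_ h2 h1 h3 h4] := monomials_le_weight Px.
  rewrite (_ : 4 * delta * W x = 2 * delta * (2 * W x)); last by ring.
  by apply: ler_wpM2l; lra.
- by apply: integral_weightZ; lra.
Qed.

Lemma volume_transport_integral_le (th : R) : 0 <= th <= 1 ->
  `|\int[m]_(x in phase) (x.2 * d_v (fun y => th * f y) x)| <= 4 * delta * b.
Proof.
have d0 := delta0 => /andP[th0 th1].
have e0 : 0 < eps by case/andP: eps01.
apply: (normr_Rintegral_le_majorant _ (measurable_scaled_weight (4 * delta))).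
- exact: measurable_phase.
- move=> x Px; rewrite d_vZ//; last exact: class_C1_trunc_area.
  rewrite d_v_trunc_area//.
  rewrite mulrCA normrM ger0_norm//.
  rewrite (le_trans (ler_piMl _ th1))//.
  apply: (le_trans (trunc_area_v_dist delta0 eps01 Px)).
  have [_ h2 h1 h3 h4] := monomials_le_weight Px.
  rewrite (_ : 4 * delta * W x = 2 * delta * (2 * W x)); last by ring.
  by apply: ler_wpM2l; lra.
- by apply: integral_weightZ; lra.
Qed.

(** For fixed x the inner integral is bounded by a multiple of W x, which is then the majorant for
    the outer one. The factor 1/2 of [fusion] turns 864 into 432. *)
Lemma fusion_integral_le (beta K0 th : R) (K : R * R -> R * R -> R) :
  0 < beta < 1 -> 0 < K0 -> 0 <= th <= 1 ->
  (forall x y, phase x -> phase y -> 0 <= K x y <=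
    K0 * (x.2 `^ (- alpha) * y.2 `^ beta + y.2 `^ (- alpha) * x.2 `^ beta)) ->
  `|fusion K m (fun x => th * f x)| <= 432 * delta * K0 * b ^+ 2.
Proof.
move=> beta01 K00 /andP[th0 th1] hK; have d0 := delta0; have b0 := weight_bound_ge0.
rewrite /fusion normrM ger0_norm ?invr_ge0//.
rewrite (_ : 432 * _ * _ * _ = 2^-1 * (864 * delta * K0 * b * b)); last by field.
rewrite ler_wpM2l ?invr_ge0//.
have cc : 0 <= 864 * delta * K0.
  exact: mulr_ge0 (mulr_ge0 (ler0n R 864) (ltW d0)) (ltW K00).
apply: (normr_Rintegral_le_majorant _ (measurable_scaled_weight (864 * delta * K0 * b))).
- exact: measurable_phase.
- move=> x Px.
  have Wx : 0 <= W x by exact: weight_ge0.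
  rewrite (_ : _ * b * W x = 864 * delta * K0 * W x * b); last by ring.
  apply: (normr_Rintegral_le_majorant _ (measurable_scaled_weight (864 * delta * K0 * W x))).
  + exact: measurable_phase.
  + move=> y Py.
    rewrite -!mulrBr mulrCA normrM (ger0_norm th0).
    rewrite (le_trans (ler_piMl _ th1))// -[leRHS]mulrA.
    exact: (fusion_integrand_le delta0 sigma alpha0 beta01 mu0 eps01 Px Py (hK _ _ Px Py) K00).
  + by apply: integral_weightZ; rewrite mulr_ge0.
- by apply: integral_weightZ; rewrite mulr_ge0.
Qed.

End moments.

(** * The drift term *)

Lemma powR_mul_exp (R : realType) (a p q : R) : 0 < a -> a `^ p * a `^ q = a `^ (p + q).
Proof. by move=> a0; rewrite powRD// (gt_eqF a0) implybT. Qed.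

Section drift.
Variables (R : realType) (alpha mu sigma eps delta b R1 : R) (m : plane_measure R)
  (r : R * R -> R).
Hypotheses (alpha0 : 0 < alpha) (mu0 : mu < 0) (eps01 : 0 < eps < 1)
  (delta0 : 0 < delta) (sigma_ge : - alpha - 1 <= sigma) (R10 : 0 < R1).
Let W (x : R * R) := weight alpha mu sigma eps x.1 x.2.
Hypothesis mI : MplusI m.
Hypothesis mW : (moment m (weight alpha mu sigma eps) <= b%:E)%E.
Hypothesis r_bounds : forall x, phase x -> 0 <= r x <= R1 * x.1 `^ mu * x.2 `^ sigma.
Local Notation f := (trunc_area delta eps).

Let sigma_le : sigma <= Num.max (1 + eps) (sigma + 2 / 3).
Proof. by apply: (@le_trans _ _ (sigma + 2 / 3)); [lra|rewrite le_max lexx orbT]. Qed.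

Let good x : phase x -> ~ [set x : R * R | phase x /\ x.1 < c0 * x.2 `^ (2 / 3)] x ->
  0 <= c0 * x.2 `^ (2 / 3) <= x.1.
Proof.
move=> Px nb; rewrite mulr_ge0 ?powR_ge0 ?(ltW (c0_gt0 R))//=.
by rewrite leNgt; apply/negP => h; apply: nb.
Qed.

(** Since mu < 0, the exponent mu + i stays in [mu, 2]. The upper drift bound takes i = 2, the error
    in the lower one i = 0. *)
Let rateW i x : phase x -> 0 <= i <= 2 -> x.1 `^ (mu + i) * x.2 `^ sigma <= W x.
Proof.
move=> [a0 v0] hi; apply: monomial_le_weight => //; last by rewrite sigma_ge sigma_le.
by have := mu0; lra.
Qed.

Let driftE th x : phase x ->
  r x * (c0 * x.2 `^ (2 / 3) - x.1) * d_a (fun y => th * f y) x =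
  th * (r x * (c0 * x.2 `^ (2 / 3) - x.1) * trunc_area_a delta eps x).
Proof.
move=> Px; have e0 : 0 < eps by case/andP: eps01.
by rewrite d_aZ ?d_a_trunc_area//; [ring|exact: class_C1_trunc_area].
Qed.

Lemma drift_integral_le th : 0 <= th <= 1 ->
  \int[m]_(x in phase) (r x * (c0 * x.2 `^ (2 / 3) - x.1) * d_a (fun y => th * f y) x)
    <= 2 * delta * R1 * b.
Proof.
move=> /andP[th0 th1].
have c0 : 0 <= 2 * delta * R1 by rewrite !mulr_ge0// ltW.
apply: (Rintegral_le_majorant (@measurable_phase R) (@measurable_nonisoperimetric R) _
  (measurable_scaled_weight alpha mu sigma eps (2 * delta * R1))).
- by case: mI.
- by move=> x Px; rewrite mulr_ge0// weight_ge0.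
- move=> x Px /(good Px) hx; rewrite driftE//.
  have h := trunc_drift_le eps delta0 Px (r_bounds Px) hx.
  have Wx : 0 <= 2 * delta * R1 * W x by rewrite mulr_ge0// weight_ge0.
  apply: le_trans (_ : th * (2 * delta * R1 * W x) <= _); last exact: ler_piMl.
  rewrite ler_wpM2l//; apply: (le_trans h).
  rewrite -!mulrA ler_wpM2l// ler_wpM2l ?(ltW delta0)// ler_wpM2l ?(ltW R10)//.
  have [a0 v0] := Px.
  rewrite -(powR_mulrn 2 (ltW a0)) mulrCA powR_mul_exp// mulrC.
  by apply: rateW => //; lra.
- exact: integral_weightZ.
Qed.

(** The majorant h stays abstract because its choice depends on whether mu > -1. The factor th is
    kept on the main term, where its decay matters, and bounded by 1 in the error. *)
Lemma drift_integral_ge th (h : R * R -> R) (J : R) : 0 <= th <= 1 ->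
  measurable_fun phase h -> (forall x, phase x -> 0 <= h x) ->
  (forall x, phase x -> c0 * x.2 `^ (2 / 3) <= x.1 ->
     x.1 `^ (mu + 1) * x.2 `^ sigma <= h x) ->
  (\int[m]_(x in phase) (h x)%:E <= J%:E)%E ->
  - (th * (R1 * J) + 2 * delta * R1 * b) <=
  \int[m]_(x in phase) (r x * (c0 * x.2 `^ (2 / 3) - x.1) * d_a (fun y => th * f y) x).
Proof.
move=> /andP[th0 th1] mh h0 hh hJ.
have c0 : 0 <= 2 * delta * R1 by rewrite !mulr_ge0// ltW.
have tR : 0 <= th * R1 by rewrite mulr_ge0// ltW.
have mS := measurable_scaled_weight alpha mu sigma eps (2 * delta * R1).
have mh' : measurable_fun phase (fun x => th * R1 * h x).
  by apply: measurable_funM => //; exact: measurable_cst.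
apply: (Rintegral_ge_majorant (@measurable_phase R) (@measurable_nonisoperimetric R) _
  (measurable_funD mh' mS)).
- by case: mI.
- move=> x Px; apply: addr_ge0; first by rewrite mulr_ge0// h0.
  by rewrite mulr_ge0// weight_ge0.
- move=> x Px /(good Px) hx; rewrite driftE//.
  have hd := trunc_drift_ge eps delta0 Px (r_bounds Px) hx.
  have Wx : 0 <= 2 * delta * R1 * W x by rewrite mulr_ge0// weight_ge0.
  apply: le_trans (ler_wpM2l th0 hd); rewrite mulrN lerN2 mulrDr lerD//.
    rewrite -[leRHS]mulrA ler_wpM2l// -!mulrA ler_wpM2l ?(ltW R10)//.
    have [a0 v0] := Px.
    rewrite (_ : _ * (_ * _) = x.1 `^ mu * x.1 `^ 1 * x.2 `^ sigma); last first.
      by rewrite powRr1 ?(ltW a0)// mulrAC mulrA.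
    by rewrite powR_mul_exp//; apply: hh => //; case/andP: hx.
  apply: le_trans (_ : th * (2 * delta * R1 * W x) <= _); last exact: ler_piMl.
  rewrite ler_wpM2l// -!mulrA ler_wpM2l// ler_wpM2l ?(ltW delta0)// ler_wpM2l ?(ltW R10)//.
  by have := @rateW 0 x Px; rewrite addr0; apply; lra.
- apply: (ge0_integralD_le (@measurable_phase R) mh' mS).
  + by move=> x Px; rewrite mulr_ge0// h0.
  + by move=> x Px; rewrite mulr_ge0// weight_ge0.
  + by rewrite (mulrA th); exact: (ge0_integralZl_le (@measurable_phase R) mh tR h0 hJ).
  + exact: integral_weightZ.
Qed.

End drift.

(** A crude weighted Young inequality: the weighted geometric mean lies below the larger of x and y.
    Exchanging x and y exchanges p and 1 - p. *)
Lemma powR_interpolation (R : realType) (p x y : R) : 0 <= p <= 1 -> 0 <= x -> 0 <= y ->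
  x `^ (1 - p) * y `^ p <= x + y.
Proof.
move=> /andP[p0 p1] x0 y0.
wlog xy : p x y p0 p1 x0 y0 / x <= y.
  move=> H; have [xy|/ltW yx] := leP x y; first exact: H.
  have q0 : 0 <= 1 - p by lra.
  have q1 : 1 - p <= 1 by lra.
  by have := H _ _ _ q0 q1 y0 x0 yx; rewrite subKr mulrC (addrC y).
have h : x `^ (1 - p) <= y `^ (1 - p) by apply: ge0_ler_powR; rewrite ?nnegrE//; lra.
apply: le_trans (ler_wpM2r (powR_ge0 _ _) h) _.
rewrite -powRD subrK ?oner_eq0//.
by rewrite powRr1// lerDr.
Qed.

(* Hoelder's inequality with the moment of order sigma/|mu| if mu > -1, and
   a^(mu+1) <= (c0 v^(2/3))^(mu+1) with the moment of order gamma-1/3 otherwise. *)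
Lemma area_loss_majorant (R : realType) (gamma mu sigma C1 N : R) (m : plane_measure R) :
  mu < 0 -> 2 / 3 * mu + sigma = gamma - 1 -> 0 < C1 -> 0 < N ->
  (moment m (fun a _ => a) <= N%:E)%E ->
  (moment m (fun _ v => (v `^ (sigma / `|mu|))%R) <= C1%:E)%E ->
  (moment m (fun _ v => (v `^ (gamma - 3^-1))%R) <= C1%:E)%E ->
  let p := Num.min (- mu) 1 in
  let k := if -1 < mu then 2 * C1 `^ p else c0 `^ (mu + 1) * C1 in
  exists h : R * R -> R, [/\ measurable_fun phase h,
    forall x, phase x -> 0 <= h x,
    forall x, phase x -> c0 * x.2 `^ (2 / 3) <= x.1 ->
      x.1 `^ (mu + 1) * x.2 `^ sigma <= h x
    & (\int[m]_(x in phase) (h x)%:E <= (k * N `^ (1 - p))%:E)%E].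
Proof.
move=> mu0 hom C10 N0 hN h1 h2 p k; rewrite /k /p; case: ifPn => hmu.
- rewrite min_l; last by lra.
  (* Hoelder is obtained from the pointwise interpolation applied to a / N and v^(sigma/|mu|) / C1.
     Both have integral at most 1, which yields the factor 2, and c restores the normalization. *)
  set c := N `^ (1 - - mu) * C1 `^ (- mu).
  have cp : 0 <= c by rewrite mulr_ge0 ?powR_ge0.
  have cN : 0 <= c / N by rewrite divr_ge0// ltW.
  have cC : 0 <= c / C1 by rewrite divr_ge0// ltW.
  have m1 : measurable_fun phase (fun x : R * R => c / N * x.1).
    apply: measurable_funM; first exact: measurable_cst.
    exact: measurable_funTS measurable_fst.
  have m2 : measurable_fun phase (fun x : R * R => c / C1 * x.2 `^ (sigma / `|mu|)).
    apply: measurable_funM; first exact: measurable_cst.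
    by apply: measurable_funTS; exact: measurable_powR_snd.
  exists (fun x => c / N * x.1 + c / C1 * x.2 `^ (sigma / `|mu|)); split.
  + exact: measurable_funD.
  + by move=> x [a0 v0]; rewrite addr_ge0// mulr_ge0 ?powR_ge0 ?(ltW a0).
  + move=> x [a0 v0] _.
    have p0 : - mu != 0 by rewrite oppr_eq0 lt_eqF.
    have := @powR_interpolation _ (- mu) (x.1 / N) (x.2 `^ (sigma / `|mu|) / C1).
    have hp : 0 <= - mu <= 1 by lra.
    have ha : 0 <= x.1 / N by rewrite divr_ge0// ltW.
    have hv : 0 <= x.2 `^ (sigma / `|mu|) / C1 by rewrite divr_ge0 ?powR_ge0// ltW.
    move=> /(_ hp ha hv) /(ler_wpM2l cp).
    rewrite mulrDr => H.
    rewrite (_ : c / N * x.1 = c * (x.1 / N)); last by ring.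
    rewrite (_ : c / C1 * _ = c * (x.2 `^ (sigma / `|mu|) / C1)); last by ring.
    apply: le_trans H.
    rewrite (_ : c * _ = (x.1 / N) `^ (1 - - mu) * N `^ (1 - - mu) *
      ((x.2 `^ (sigma / `|mu|) / C1) `^ (- mu) * C1 `^ (- mu))); last by rewrite /c; ring.
    rewrite -!powRM ?(ltW N0) ?(ltW C10)// !divfK ?gt_eqF//.
    by rewrite -powRrM ltr0_norm// divfK// opprK addrC.
  + rewrite (_ : 2 * _ * _ = c / N * N + c / C1 * C1); last first.
      by rewrite /c !divfK ?gt_eqF//; ring.
    apply: (ge0_integralD_le (@measurable_phase R) m1 m2).
    * by move=> x [a0 v0]; rewrite mulr_ge0// ltW.
    * by move=> x [a0 v0]; rewrite mulr_ge0// powR_ge0.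
    * apply: (ge0_integralZl_le (@measurable_phase R) _ cN _ hN).
        exact: measurable_funTS measurable_fst.
      by move=> x [a0 v0]; exact: ltW.
    * apply: (ge0_integralZl_le (@measurable_phase R) _ cC _ h1).
        by apply: measurable_funTS; exact: measurable_powR_snd.
      by move=> x _; exact: powR_ge0.
- rewrite min_r; last by lra.
  rewrite subrr powRr0 mulr1.
  have c0g := @c0_gt0 R.
  have m2 : measurable_fun phase (fun x : R * R => x.2 `^ (gamma - 3^-1)).
    by apply: measurable_funTS; exact: measurable_powR_snd.
  exists (fun x => c0 `^ (mu + 1) * x.2 `^ (gamma - 3^-1)); split.
  + by apply: measurable_funM => //; exact: measurable_cst.
  + by move=> x _; rewrite mulr_ge0// powR_ge0.
  + move=> x [a0 v0] hx.
    (* The exponent identity is the homogeneity relation. As mu + 1 <= 0, the lower bound on a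
       becomes an upper bound on a^(mu + 1), obtained by inverting powers with exponent -(mu + 1) >=
       0. *)
    rewrite (_ : gamma - 3^-1 = 2 / 3 * (mu + 1) + sigma); last by lra.
    rewrite (@powRD _ x.2) ?(gt_eqF v0) ?implybT// mulrA ler_wpM2r ?powR_ge0//.
    have pa : 0 < x.1 `^ (- (mu + 1)) by exact: powR_gt0.
    have pc : 0 < (c0 * x.2 `^ (2 / 3)) `^ (- (mu + 1)).
      by apply: powR_gt0; apply: mulr_gt0 => //; exact: powR_gt0.
    rewrite powRrM -powRM ?powR_ge0 ?(ltW c0g)//.
    rewrite -[mu + 1]opprK !(powRN _ (- (mu + 1))) lef_pV2 ?posrE//.
    apply: ge0_ler_powR; rewrite ?nnegrE ?(ltW a0)//; first by lra.
    by rewrite mulr_ge0 ?powR_ge0 ?(ltW c0g).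
  + have k0 : 0 <= (c0 : R) `^ (mu + 1) by exact: powR_ge0.
    apply: (ge0_integralZl_le (@measurable_phase R) m2 k0 _ h2).
    by move=> x _; exact: powR_ge0.
Qed.

(** * The truncated balance of area *)

Section time_integral.
Variables (R : realType) (t : R).
Hypothesis t0 : 0 < t.
Local Notation mu := (@lebesgue_measure R).

Lemma integral_time_cst (c : R) : (\int[mu]_(s in `[0%R, t]) c%:E = (c * t)%:E)%E.
Proof.
rewrite integral_cst; last exact: measurable_itv.
by rewrite /= lebesgue_measure_itv/= lte_fin t0 oppr0 adde0 EFinM.
Qed.

Lemma time_integral_norm_le (F : R -> R) (c : R) :
  (forall s, 0 <= s <= t -> `|F s| <= c) ->
  `|\int[mu]_(s in `[0%R, t]) F s| <= c * t.
Proof.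
move=> H; apply: (@normr_Rintegral_le_majorant _ _ _ _ _ _ (cst c)).
- exact: measurable_itv.
- exact: measurable_cst.
- by move=> s; rewrite /= in_itv/=; exact: H.
- by rewrite integral_time_cst.
Qed.

Lemma time_integral_le (F : R -> R) (c : R) : 0 <= c ->
  (forall s, 0 <= s <= t -> F s <= c) ->
  \int[mu]_(s in `[0%R, t]) F s <= c * t.
Proof.
move=> c0 H; apply: (@Rintegral_le_majorant _ _ _ _ _ set0 _ (cst c)) => //.
- by move=> s; rewrite /= in_itv/= => hs _; exact: H.
- by rewrite integral_time_cst.
Qed.

(** Dropping the endpoint term at t makes the bound independent of t; this is what keeps the total
    loss bounded for all times. *)
Lemma integral_exp_decay (A q : R) : 0 <= A -> 0 < q ->
  (\int[mu]_(s in `[0%R, t]) (A * expR (- (q * s)))%:E <= (A / q)%:E)%E.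
Proof.
move=> A0 q0.
pose F s := - (A / q) * expR (- (q * s)).
have dF (s : R) : is_derive s 1 F (A * expR (- (q * s))).
  have h1 : is_derive s 1 (fun s : R => - (q * s)) (- q).
    by apply: is_derive_eq; rewrite /GRing.scale/= mulr1.
  have h2 := @is_derive1_comp _ expR (fun s : R => - (q * s)) s _ _ (is_derive_expR _) h1.
  have h3 := is_deriveZ (- (A / q)) h2.
  apply: (@is_derive_eq _ _ _ _ _ _ _ _ h3); rewrite /GRing.scale/=.
  by field; rewrite gt_eqF.
have cF : continuous F.
  move=> s; apply: differentiable_continuous; apply/derivable1_diffP.
  exact: (@ex_derive _ _ _ _ _ _ _ (dF s)).
rewrite (@continuous_FTC2 _ (fun s => A * expR (- (q * s))) F)//.
- rewrite -EFinB lee_fin /F mulr0 oppr0 expR0.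
  have := expR_ge0 (- (q * t)); have : 0 <= A / q by rewrite divr_ge0// ltW.
  by move=> h1 h2; have := mulr_ge0 h1 h2; lra.
- apply: continuous_subspaceT => s; apply: cvgM; first exact: cvg_cst.
  apply: (@continuous_comp _ _ _ (fun s : R => - (q * s)) expR);
    last exact: continuous_expR.
  by apply: cvgN; apply: cvgM; [exact: cvg_cst|exact: cvg_id].
- split.
  + by move=> s _; have [] := dF s.
  + by apply: cvg_at_right_filter; exact: cF.
  + by apply: cvg_at_left_filter; exact: cF.
- by move=> s _; rewrite derive1E; have [_ ->] := dF s.
Qed.

End time_integral.

(** X and Y are the time integrals of f and a f_a against the time factor, V is volume transport, Z
    fusion, D drift. The rate 1/3 enters through X - X/3 - (2/3) Y = (2/3) (X - Y), a difference of
    order delta. *)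
Lemma balance_remainder_le (R : realType) (gamma p p0 X Y V Z D a c : R) :
  0 <= gamma < 1 ->
  p - p0 - - 3^-1 * X = X - 2 / 3 * Y - V + (1 - gamma) * Z + (1 - gamma) * D ->
  `|X - Y| <= a -> `|V| <= a -> `|Z| <= c ->
  `|p - p0 - (1 - gamma) * D| <= a + a + c.
Proof.
move=> g01 E XY hV hZ.
have -> : p - p0 - (1 - gamma) * D = 2 / 3 * (X - Y) - V + (1 - gamma) * Z by lra.
have g0 : 0 <= 1 - gamma by lra.
have g1 : 1 - gamma <= 1 by lra.
have h : (0 : R) <= 2 / 3 by lra.
apply: le_trans (ler_normD _ _) _; apply: lerD.
  apply: le_trans (ler_normB _ _) _; apply: lerD => //.
  by rewrite normrM (ger0_norm h); apply: le_trans XY; rewrite ler_piMl//; lra.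
by rewrite normrM (ger0_norm g0); apply: le_trans hZ; rewrite ler_piMl.
Qed.

Section truncated_balance.
Variables (R : realType) (alpha beta gamma mu sigma eps delta b K0 t : R).
Variables (K : R * R -> R * R -> R) (r : R * R -> R) (g : R -> plane_measure R).
Hypotheses (alpha0 : 0 < alpha) (mu0 : mu < 0) (beta01 : 0 < beta < 1)
  (eps01 : 0 < eps < 1) (gamma01 : 0 <= gamma < 1) (delta0 : 0 < delta)
  (K00 : 0 < K0) (t0 : 0 < t).
Hypothesis sol : weak_solution alpha beta gamma K r g.
Hypothesis bound : forall s, 0 <= s <= t ->
  (moment (g s) (weight alpha mu sigma eps) <= b%:E)%E.
Hypothesis hK : forall x y, phase x -> phase y -> 0 <= K x y <=
    K0 * (x.2 `^ (- alpha) * y.2 `^ beta + y.2 `^ (- alpha) * x.2 `^ beta).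
Local Notation f := (trunc_area delta eps).
Local Notation fa := (trunc_area_a delta eps).
Local Notation th := (decay t).

Let eps0 : 0 < eps. Proof. by case/andP: eps01. Qed.

Lemma decay_itv s : 0 <= s <= t -> 0 <= th s <= 1.
Proof.
by move=> /andP[s0 st]; rewrite decayE// expR_ge0/= -[leRHS]expR0 ler_expR oppr_le0 divr_ge0.
Qed.

Definition truncated_drift (s : R) : R :=
  \int[g s]_(x in phase)
    (r x * (c0 * x.2 `^ (2 / 3) - x.1) * d_a (fun y => th s * f y) x).

Let m (s : R) := \int[g s]_(x in phase) f x.
Let A (s : R) := \int[g s]_(x in phase) (x.1 * fa x).

Let curve_continuous (h : R * R -> R) : Cc h ->
  {within `[0, t], continuous (fun s => th s * \int[g s]_(x in phase) h x)}.
Proof.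
move=> Ch; have [[_ cg] _ _] := sol.
have tsub : [set` `[0, t]] `<=` [set` `[(0:R), +oo[].
  by move=> s; rewrite /= !in_itv/= andbT => /andP[].
have cm := continuous_subspaceW tsub (cg h Ch).
have ct : {within `[0, t], continuous th}.
  by apply: continuous_subspaceT; exact: decay_continuous.
by move=> s; apply: cvgM; [exact: ct|exact: cm].
Qed.

Let curve_integrable (h : R * R -> R) : Cc h ->
  lebesgue_measure.-integrable `[0, t]
    (EFin \o (fun s => th s * \int[g s]_(x in phase) h x)).
Proof.
move=> Ch; apply: continuous_compact_integrable; first exact: segment_compact.
exact: curve_continuous.
Qed.

(** The drift stays inside the absolute value as a main term, to be bounded from each side
    separately. Transport in a and in v accounts for 4 + 4 = 8. *)
Lemma truncated_balance :
  `|th t * m t - m 0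
      - (1 - gamma) * \int[lebesgue_measure]_(s in `[0, t]) truncated_drift s|
    <= delta * ((8 * b + 432 * K0 * b ^+ 2) * t).
Proof.
have C1f := class_C1_trunc_area delta eps.
have Csf := compact_support_trunc_area delta0 eps0.
have tc : test_curve (fun s x => th s * f x) (fun s x => decay' t s * f x).
  exact: (test_curve_tensor C1f Csf (is_derive_decay t) (@decay'_continuous _ t)
    (@decay_eq0 _ t)).
have [_ _ /(_ _ _ tc t (ltW t0)) balance] := sol.
have Zm c s : 0 <= s <= t -> \int[g s]_(x in phase) (c * f x) = c * m s.
  move=> /bound hs; apply: RintegralZl; first exact: measurable_phase.
  exact: integrable_trunc_area hs.
have fa_int s : 0 <= s <= t -> (g s).-integrable phase (EFin \o (fun x => x.1 * fa x)).
  by move=> /bound hs; exact: integrable_mul_trunc_area_a hs.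
have I0 : (0 : R) <= 0 <= t by apply/andP; split => //; exact: ltW.
have It : 0 <= t <= t by apply/andP; split => //; exact: ltW.
pose TI (F : R -> R) := \int[lebesgue_measure]_(s in `[0, t]) F s.
have eTI F G : (forall s, 0 <= s <= t -> F s = G s) -> TI F = TI G.
  by move=> FG; apply: eq_Rintegral => s; rewrite inE /= in_itv/=; exact: FG.
have intm := curve_integrable (Cc_trunc_area delta0 eps0).
have intA := curve_integrable (Cc_mul_trunc_area_a delta0 eps0).
pose X := TI (fun s => th s * m s); pose Y := TI (fun s => th s * A s).
pose V := TI (fun s => \int[g s]_(x in phase) (x.2 * d_v (fun y => th s * f y) x)).
pose Z := TI (fun s => fusion K (g s) (fun x => th s * f x)).
pose D := TI truncated_drift.
have e1 : TI (fun s => \int[g s]_(x in phase) (decay' t s * f x)) = - 3^-1 * X.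
  rewrite /X /TI -RintegralZl; [|exact: measurable_itv|exact: intm].
  apply: eTI => s hs; rewrite (Zm _ _ hs) decay'E; last by case/andP: hs.
  by ring.
have e2 : TI (fun s => \int[g s]_(x in phase) (th s * f x)) = X.
  by apply: eTI => s hs; rewrite Zm.
have e3 : TI (fun s => \int[g s]_(x in phase) (x.1 * d_a (fun y => th s * f y) x)) = Y.
  apply: eTI => s hs; rewrite /A -RintegralZl; [|exact: measurable_phase|exact: fa_int].
  apply: eq_Rintegral => x; rewrite inE => Px.
  by rewrite d_aZ// d_a_trunc_area// mulrCA.
have e4 : \int[g 0]_(x in phase) (th 0 * f x) = m 0.
  by rewrite (Zm _ _ I0) decayE ?(ltW t0)// mul0r oppr0 expR0 mul1r.
(* Substituting by hand: [rewrite] would compare the integrands up to conversion. *)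
have subst (p0 d q a p0' d' q' a' p v z w : R) : p0 = p0' -> d = d' -> q = q' -> a = a' ->
    p - p0 - d = q - 2 / 3 * a - v + (1 - gamma) * z + (1 - gamma) * w ->
    p - p0' - d' = q' - 2 / 3 * a' - v + (1 - gamma) * z + (1 - gamma) * w.
  by move=> -> -> -> ->.
have E : th t * m t - m 0 - - 3^-1 * X =
    X - 2 / 3 * Y - V + (1 - gamma) * Z + (1 - gamma) * D.
  by rewrite -(Zm _ _ It); exact: (subst _ _ _ _ _ _ _ _ _ _ _ _ e4 e1 e2 e3 balance).
have b0 : 0 <= b := weight_bound_ge0 (bound I0).
have hmA : `|X - Y| <= 4 * delta * b * t.
  rewrite /X /Y /TI -RintegralB; [|exact: measurable_itv|exact: intm|exact: intA].
  apply: (time_integral_norm_le t0) => s hs.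
  have /andP[h0 h1] := decay_itv hs.
  rewrite -mulrBr normrM ger0_norm// (le_trans (ler_piMl _ h1))//.
  exact: (trunc_area_a_integral_dist alpha0 mu0 eps01 delta0 (bound hs)).
have hV : `|V| <= 4 * delta * b * t.
  apply: (time_integral_norm_le t0) => s hs.
  exact: (volume_transport_integral_le alpha0 mu0 eps01 delta0 (bound hs) (decay_itv hs)).
have hF : `|Z| <= 432 * delta * K0 * b ^+ 2 * t.
  apply: (time_integral_norm_le t0) => s hs.
  exact: (fusion_integral_le alpha0 mu0 eps01 delta0 (bound hs) beta01 K00
    (decay_itv hs) hK).
rewrite (_ : delta * _ = 4 * delta * b * t + 4 * delta * b * t +
  432 * delta * K0 * b ^+ 2 * t); last by ring.
exact: (balance_remainder_le gamma01 E hmA hV hF).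
Qed.

End truncated_balance.

(** * Growth of the area *)

(** The limit delta -> 0, for errors that are multiples of delta. *)
Lemma le0_of_le_mul_pos (R : realType) (x c : R) :
  (forall e : R, 0 < e -> x <= e * c) -> x <= 0.
Proof.
move=> H; rewrite leNgt; apply/negP => x0.
have c1 : 0 < `|c| + 1 by rewrite ltr_wpDl.
have e0 : 0 < x / (2 * (`|c| + 1)) by rewrite divr_gt0// mulr_gt0.
have := H _ e0; rewrite mulrAC ler_pdivlMr ?mulr_gt0//.
by have := ler_norm c; nra.
Qed.

Definition decay_power {R : realType} (mu : R) : R := Num.min (- mu) 1.

(** The constant [k] of [area_loss_majorant]. *)
Definition loss_constant {R : realType} (mu C1 : R) : R :=
  if -1 < mu then 2 * C1 `^ decay_power mu else c0 `^ (mu + 1) * C1.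

(** The solution M of (3 v0 k / p) M^(1 - p) = M / 2, with p the [decay_power] and k the
    [loss_constant]. The factor 3 / p is the integral of e^(-p s / 3) over all times, and v0 stands
    in for R1. *)
Definition area_threshold {R : realType} (v0 C1 mu : R) : R :=
  (6 * v0 * loss_constant mu C1 / decay_power mu) `^ (decay_power mu)^-1.

Lemma decay_power_gt0 (R : realType) (mu : R) : mu < 0 -> 0 < decay_power mu.
Proof. by move=> mu0; rewrite /decay_power lt_min ltr01 oppr_gt0 mu0. Qed.

Lemma loss_constant_gt0 (R : realType) (mu C1 : R) : 0 < C1 -> 0 < loss_constant mu C1.
Proof.
move=> C10; rewrite /loss_constant; case: ifP => _.
  by apply: mulr_gt0 => //; exact: powR_gt0.
by apply: mulr_gt0 => //; apply: powR_gt0; exact: c0_gt0.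
Qed.

Lemma area_threshold_gt0 (R : realType) (v0 C1 mu : R) :
  0 < v0 -> 0 < C1 -> mu < 0 -> 0 < area_threshold v0 C1 mu.
Proof.
move=> v00 C10 mu0; have k0 := loss_constant_gt0 mu C10; have p0 := decay_power_gt0 mu0.
apply: powR_gt0; apply: divr_gt0 => //; apply: mulr_gt0 => //.
by apply: mulr_gt0.
Qed.

Lemma area_threshold_powR (R : realType) (v0 C1 mu : R) :
  0 < v0 -> 0 < C1 -> mu < 0 ->
  area_threshold v0 C1 mu `^ decay_power mu =
    6 * v0 * loss_constant mu C1 / decay_power mu.
Proof.
move=> v00 C10 mu0; have k0 := loss_constant_gt0 mu C10; have p0 := decay_power_gt0 mu0.
rewrite /area_threshold -powRrM mulVf ?gt_eqF// powRr1//.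
apply: divr_ge0 (ltW p0); apply: mulr_ge0 (ltW k0).
by apply: mulr_ge0 => //; exact: ltW.
Qed.

Section area_growth.
Variables (R : realType) (alpha beta gamma mu sigma eps b v0 K0 C1 R1 t : R).
Variables (K : R * R -> R * R -> R) (r : R * R -> R) (g : R -> plane_measure R).
Hypotheses (alpha0 : 0 < alpha) (mu0 : mu < 0) (beta01 : 0 < beta < 1)
  (eps01 : 0 < eps < 1) (gamma01 : 0 <= gamma < 1) (v00 : 0 < v0)
  (K00 : 0 < K0) (C10 : 0 < C1) (R10 : 0 < R1) (R1v0 : R1 <= v0)
  (homogeneity : 2 / 3 * mu + sigma = gamma - 1).
Hypothesis sol : weak_solution alpha beta gamma K r g.
Hypothesis bound : forall s, 0 <= s <= t ->
  (moment (g s) (weight alpha mu sigma eps) <= b%:E)%E.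
Hypothesis hK : forall x y, phase x -> phase y -> 0 <= K x y <=
    K0 * (x.2 `^ (- alpha) * y.2 `^ beta + y.2 `^ (- alpha) * x.2 `^ beta).
Hypothesis r_bounds : forall x, phase x -> 0 <= r x <= R1 * x.1 `^ mu * x.2 `^ sigma.
Hypothesis volume_moments : forall x1 s, x1_set gamma mu sigma x1 -> 0 <= s ->
  (moment (g s) (fun _ v => (v `^ x1)%R) <= C1%:E)%E.

Let M (s : R) := \int[g s]_(x in phase) x.1.

(** Homogeneity gives sigma = gamma - 1 - (2/3) mu, which exceeds -1. *)
Let sigma_ge : - alpha - 1 <= sigma.
Proof. by move: alpha0 mu0 gamma01 homogeneity; lra. Qed.

Let MI s : 0 <= s -> MplusI (g s).
Proof. by case: sol => -[H _] _ _; exact: H. Qed.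

Let sub_bound T s : T <= t -> 0 <= s <= T ->
  (moment (g s) (weight alpha mu sigma eps) <= b%:E)%E.
Proof. by move=> Tt /andP[s0 sT]; apply: bound; rewrite s0 (le_trans sT). Qed.

Let drift_integral delta T : R :=
  \int[lebesgue_measure]_(s in `[0, T]) truncated_drift eps delta T r g s.

(** Replacing the truncated area by a at times 0 and T costs 8 delta b each, hence 16 b. *)
Lemma area_balance delta T : 0 < T <= t -> 0 < delta ->
  `|expR (- (T / 3)) * M T - M 0 - (1 - gamma) * drift_integral delta T|
    <= delta * (16 * b + (8 * b + 432 * K0 * b ^+ 2) * T).
Proof.
move=> /andP[T0 Tt] d0.
have IT : 0 <= T <= T by apply/andP; split => //; exact: ltW.
have I0 : (0 : R) <= 0 <= T by apply/andP; split => //; exact: ltW.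
have := truncated_balance alpha0 mu0 beta01 eps01 gamma01 d0 K00 T0 sol
  (fun s => sub_bound Tt) hK.
have := trunc_area_integral_dist alpha0 mu0 eps01 d0 (sub_bound Tt IT).
have := trunc_area_integral_dist alpha0 mu0 eps01 d0 (sub_bound Tt I0).
rewrite decayE// -/(M T) -/(M 0) -/(drift_integral delta T).
have e0 := expR_ge0 (- (T / 3)).
have e1 : expR (- (T / 3)) <= 1.
  by rewrite -[leRHS]expR0 ler_expR oppr_le0 divr_ge0// ltW.
move: (expR _) (M T) (M 0) (_ * drift_integral _ _) (Rintegral _ _ _) (Rintegral _ _ _)
  (_ * T) e0 e1.
clear IT I0 Tt => e MT M0 X mT m0 q e0 e1 h0 hT h.
have he : `|e * (mT - MT)| <= 8 * delta * b.
  by rewrite normrM (ger0_norm e0); apply: le_trans hT; rewrite ler_piMl.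
move: h h0 he; rewrite !ler_norml => /andP[? ?] /andP[? ?] /andP[? ?].
by apply/andP; split; lra.
Qed.

(** The balance is used on [0, s], with the time factor adapted to s. The upper drift bound is of
    order delta, so the gain disappears in the limit. *)
Lemma rescaled_area_le s : 0 <= s <= t -> expR (- (s / 3)) * M s <= M 0.
Proof.
move=> /andP[s0 st]; have [->|sn] := eqVneq s 0.
  by rewrite mul0r oppr0 expR0 mul1r.
have {sn}s0' : 0 < s by rewrite lt_neqAle eq_sym sn.
have hb : 0 <= b.
  by apply: (weight_bound_ge0 (@bound 0 _)); rewrite lexx (le_trans s0).
have Rb : 0 <= R1 * b by rewrite mulr_ge0// ltW.
have hs : 0 < s <= t by rewrite s0' st.
have up delta : 0 < delta -> drift_integral delta s <= 2 * delta * (R1 * b) * s.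
  move=> d0; apply: (time_integral_le s0') => [|u hu].
    exact: mulr_ge0 (mulr_ge0 (ler0n R 2) (ltW d0)) Rb.
  rewrite (mulrA _ R1).
  apply: (drift_integral_le mu0 eps01 d0 sigma_ge R10 (MI _) (sub_bound st hu)
    r_bounds (decay_itv hu)).
  by case/andP: hu.
pose Q := 16 * b + (8 * b + 432 * K0 * b ^+ 2) * s.
rewrite -subr_le0; apply: (@le0_of_le_mul_pos _ _ (2 * (R1 * b) * s + Q)) => delta d0.
have := area_balance hs d0; rewrite ler_norml -/Q => /andP[_].
have [g0 g1] : 0 <= 1 - gamma /\ 1 - gamma <= 1 by case/andP: gamma01 => ? ?; split; lra.
have hD := ler_wpM2l g0 (up _ d0).
have Q0 : 0 <= 2 * delta * (R1 * b) * s.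
  exact: mulr_ge0 (mulr_ge0 (mulr_ge0 (ler0n R 2) (ltW d0)) Rb) s0.
have := le_trans hD (ler_piMl Q0 g1).
rewrite (_ : delta * (_ + Q) = 2 * delta * (R1 * b) * s + delta * Q); last by ring.
move: (_ * drift_integral _ _) (_ * M s) (M 0) (delta * Q) (2 * delta * _ * s).
by move=> X Y Z q u; lra.
Qed.

Lemma area_exponential_growth : 0 < t -> area_threshold v0 C1 mu <= M 0 ->
  2^-1 * area_threshold v0 C1 mu * expR (t / 3) <= M t.
Proof.
move=> t0 hM0; have th0 := area_threshold_gt0 v00 C10 mu0.
have M00 : 0 < M 0 := lt_le_trans th0 hM0.
set p := decay_power mu; set k := loss_constant mu C1.
have p0 : 0 < p := decay_power_gt0 mu0.
have k0 : 0 < k := loss_constant_gt0 mu C10.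
have It : 0 < t <= t by rewrite t0 lexx.
have hb : 0 <= b.
  by apply: (weight_bound_ge0 (@bound 0 _)); rewrite lexx ltW.
have Rb : 0 <= R1 * b by rewrite mulr_ge0// ltW.
pose A := R1 * (k * M 0 `^ (1 - p)).
have A0 : 0 <= A.
  exact: mulr_ge0 (ltW R10) (mulr_ge0 (ltW k0) (powR_ge0 _ _)).
have drift_ge delta s : 0 < delta -> 0 <= s <= t ->
    - (A * expR (- (p / 3 * s)) + 2 * delta * R1 * b) <= truncated_drift eps delta t r g s.
  move=> d0 hs; have s0 : 0 <= s by case/andP: hs.
  (* The growth bound of [rescaled_area_le] is fed into the loss majorant as its bound N on the
     area. *)
  pose N := expR (s / 3) * M 0.
  have N0 : 0 < N by rewrite mulr_gt0// expR_gt0.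
  have hN : (moment (g s) (fun a _ => a) <= N%:E)%E.
    rewrite (moment_area alpha0 mu0 eps01 (bound hs)) lee_fin -/(M s).
    have := rescaled_area_le hs; rewrite expRN mulrC ler_pdivrMr ?expR_gt0//.
    by rewrite /N mulrC.
  have v1 := volume_moments (or_introl erefl : x1_set gamma mu sigma (sigma / `|mu|)) s0.
  have v2 := volume_moments (or_intror erefl : x1_set gamma mu sigma (gamma - 3^-1)) s0.
  have [h [mh h0 hh hJ]] := area_loss_majorant mu0 homogeneity C10 N0 hN v1 v2.
  have {}hJ : (\int[g s]_(x in phase) (h x)%:E <= (k * N `^ (1 - p))%:E)%E by exact: hJ.
  have := drift_integral_ge mu0 eps01 d0 sigma_ge R10 (MI s0) (bound hs) r_bounds
    (decay_itv hs) mh h0 hh hJ.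
  apply: le_trans; rewrite lerN2 lerD2r decayE; last by case/andP: hs.
  rewrite /A.
  rewrite /N powRM ?expR_ge0 ?(ltW M00)//.
  rewrite le_eqVlt; apply/orP; left; apply/eqP.
  (* The time factor e^(-s/3) against the growth e^((1 - p) s / 3) leaves e^(-p s / 3). *)
  rewrite (_ : expR (- (p / 3 * s)) = expR (- (s / 3)) * expR (s / 3) `^ (1 - p)).
    by ring.
  by rewrite /powR gt_eqF ?expR_gt0// expRK -expRD; congr expR; field.
have drift_int delta : 0 < delta ->
    - (A / (p / 3) + 2 * delta * R1 * b * t) <= drift_integral delta t.
  move=> d0.
  have cc : 0 <= 2 * delta * R1 * b.
    by rewrite -mulrA; exact: mulr_ge0 (mulr_ge0 (ler0n R 2) (ltW d0)) Rb.
  have mE : measurable_fun (`[0, t]%classic : set R) (fun s => A * expR (- (p / 3 * s))).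
    apply: measurable_funM; first exact: measurable_cst.
    apply: measurableT_comp; first exact: measurable_expR.
    apply: measurableT_comp => //; apply: measurable_funM => //; exact: measurable_cst.
  have mC : measurable_fun (`[0, t]%classic : set R) (fun _ => 2 * delta * R1 * b).
    exact: measurable_cst.
  apply: (@Rintegral_ge_majorant _ _ R (@lebesgue_measure R) `[0, t]%classic set0
    (truncated_drift eps delta t r g)
    (fun s : R => A * expR (- (p / 3 * s)) + 2 * delta * R1 * b)).
  - exact: measurable_itv.
  - exact: measurable0.
  - exact: measure0.
  - exact: measurable_funD mE mC.
  - by move=> s _; rewrite addr_ge0// mulr_ge0// expR_ge0.
  - by move=> s; rewrite /= in_itv/= => hs _; exact: drift_ge.
  - apply: (@ge0_integralD_le _ _ R (@lebesgue_measure R) _ _ _ _ _ (measurable_itv _) mE mC).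
    + by move=> s _; rewrite mulr_ge0// expR_ge0.
    + by [].
    + by apply: (integral_exp_decay t0 A0); rewrite divr_gt0.
    + by rewrite integral_time_cst.
(* In the limit delta -> 0 the rescaled area has lost at most (1 - gamma) 3 A / p. *)
have lower : M 0 - expR (- (t / 3)) * M t - (1 - gamma) * (A / (p / 3)) <= 0.
  pose Q := 16 * b + (8 * b + 432 * K0 * b ^+ 2) * t.
  apply: (@le0_of_le_mul_pos _ _ (2 * (R1 * b) * t + Q)) => delta d0.
  have := area_balance It d0; rewrite ler_norml -/Q => /andP[+ _].
  have [g0 g1] : 0 <= 1 - gamma /\ 1 - gamma <= 1 by case/andP: gamma01 => ? ?; split; lra.
  have hD := ler_wpM2l g0 (drift_int _ d0).
  have Q0 : 0 <= 2 * delta * R1 * b * t.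
    rewrite -(mulrA _ R1); apply: mulr_ge0 (ltW t0).
    exact: mulr_ge0 (mulr_ge0 (ler0n R 2) (ltW d0)) Rb.
  have := ler_piMl Q0 g1; move: hD; rewrite mulrN mulrDr.
  rewrite (_ : delta * (_ + Q) = 2 * delta * R1 * b * t + delta * Q); last by ring.
  move: (_ * drift_integral _ _) (_ * M t) (M 0) (delta * Q) (_ * (A / _)).
  move: ((1 - gamma) * (2 * delta * R1 * b * t)) (2 * delta * R1 * b * t).
  by move=> w u X Y Z q W; lra.
have small : (1 - gamma) * (A / (p / 3)) <= 2^-1 * M 0.
  have Ap : 0 <= A / (p / 3) by rewrite divr_ge0// ltW// divr_gt0.
  apply: (@le_trans _ _ (A / (p / 3))).
    by rewrite ler_piMl//; have := gamma01; lra.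
  rewrite ler_pdivrMr ?divr_gt0// /A.
  have hp : 6 * v0 * k / p <= M 0 `^ p.
    rewrite -(area_threshold_powR v00 C10 mu0); apply: ge0_ler_powR => //.
    - exact: ltW.
    - by rewrite nnegrE ltW.
    - by rewrite nnegrE ltW.
  (* After this splitting the common factor M(0)^(1 - p) can be removed, and it remains to compare 6
     R1 k with p M(0)^p. *)
  have MM : M 0 = M 0 `^ (1 - p) * M 0 `^ p.
    by rewrite -powRD subrK ?oner_eq0// powRr1// ltW.
  rewrite {2}MM.
  move: hp; rewrite ler_pdivrMr// => hp.
  have q0 := powR_ge0 (M 0) (1 - p).
  have hk : R1 * k <= v0 * k by rewrite ler_wpM2r// ltW.
  have h6 : 6 * (R1 * k) <= M 0 `^ p * p.
    by apply: le_trans hp; rewrite -mulrA ler_wpM2l// ler0n.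
  have := ler_wpM2l q0 h6.
  move: (M 0 `^ (1 - p)) (M 0 `^ p) => x y; lra.
have e0 : 0 < expR (t / 3) by exact: expR_gt0.
move: lower; rewrite expRN.
have -> : M t = (expR (t / 3))^-1 * M t * expR (t / 3) by rewrite mulrAC mulVf ?gt_eqF// mul1r.
move=> lower; rewrite ler_wpM2r ?(ltW e0)//.
rewrite mulrA mulrAC mulVf ?gt_eqF// mul1r in lower *.
move: (_ * M t) (M 0) (_ * (A / _)) (area_threshold _ _ _) lower small hM0 => x y z w.
by move=> ? ? ?; lra.
Qed.

End area_growth.

(** The order of quantifiers encodes the dependence of the constants: [Cmu] precedes everything, and
    [C1] and [C2] are functions of the listed parameters only, fixed before K, r and g. *)
Theorem theorem2p12 (R : realType) :
  exists Cmu : R -> R,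
    (forall mu : R, mu < 0 -> 0 < Cmu mu) /\
    forall C1 : R -> R -> R -> R -> R,
    exists C2 : R -> R -> R -> R -> R -> R -> R,
    forall (alpha beta gamma mu sigma v0 K0 K1 R0 R1 B : R)
      (K : R * R -> R * R -> R) (r : R * R -> R),
      0 < alpha -> mu < 0 -> 0 < beta < 1 ->
      gamma = beta - alpha -> 0 <= gamma < 1 -> 0 < v0 ->
      0 < K0 -> 0 < K1 -> kernel_hyp alpha beta gamma K0 K1 K ->
      0 < R0 -> 0 < R1 -> 0 < B -> rate_hyp gamma mu sigma R0 R1 B r ->
      2 / 3 * mu + sigma = gamma - 1 ->
      C1_property alpha beta gamma mu sigma v0 K r (C1 v0 K0 K1 gamma) ->
      0 < C2 v0 K0 K1 gamma mu sigma /\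
      forall g : R -> plane_measure R,
        weak_solution alpha beta gamma K r g ->
        (forall t : R, 0 <= t -> moment (g t) (fun _ v => v) = v0%:E) ->
        (forall x1 : R, x1_set gamma mu sigma x1 ->
           (ereal_sup [set moment (g t) (fun _ v => (v `^ x1)%R)
                      | t in `[0%R, +oo[] <= (C1 v0 K0 K1 gamma)%:E)%E) ->
        (exists eps : R, 0 < eps < 1 /\
           locally_bounded_moment g (weight alpha mu sigma eps)) ->
        R1 <= v0 ->
        ((C2 v0 K0 K1 gamma mu sigma)%:E <= moment (g 0%R) (fun a _ => a))%E ->
        forall t : R, 0 <= t ->
          ((Cmu mu * C2 v0 K0 K1 gamma mu sigma * expR (t / 3))%:E
             <= moment (g t) (fun a _ => a))%E.
Proof.
exists (fun _ => 2^-1); split => [mu _|C1]; first by rewrite invr_gt0.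
exists (fun v0 K0 K1 gamma mu _ => area_threshold v0 (C1 v0 K0 K1 gamma) mu).
move=> alpha beta gamma mu sigma v0 K0 K1 R0 R1 B K r alpha0 mu0 beta01 _ gamma01
  v00 K00 _ hypK R00 R10 _ hypr homogeneity [C10 _].
have threshold0 := area_threshold_gt0 v00 C10 mu0.
split => // g sol _ volume [eps [eps01 loc]] R1v0 area0 t t_ge0.
(* The local moment bound and the time integrals are stated for positive times only. *)
have [t0|t0] := eqVneq t 0.
  rewrite t0 mul0r expR0 mulr1; apply: le_trans area0.
  by rewrite lee_fin ler_piMl ?ltW// invf_lt1// ltr1n.
have {t0}t_gt0 : 0 < t by rewrite lt_neqAle eq_sym t0.
have [b bound] : exists b, forall s, 0 <= s <= t ->
    (moment (g s) (weight alpha mu sigma eps) <= b%:E)%E.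
  have sup_ub s : 0 <= s <= t -> (moment (g s) (weight alpha mu sigma eps) <=
      ereal_sup [set moment (g s) (weight alpha mu sigma eps) | s in `[0%R, t]])%E.
    by move=> hs; apply: ereal_sup_ubound; exists s => //=; rewrite in_itv.
  have := loc t t_gt0; case: ereal_sup sup_ub => [b ub _|//|ub _]; first by exists b.
  (* If the supremum were -oo, any real b would serve. *)
  by exists 0 => s /ub; rewrite leeNy_eq => /eqP ->; rewrite leNye.
have hK x y : phase x -> phase y -> 0 <= K x y <=
    K0 * (x.2 `^ (- alpha) * y.2 `^ beta + y.2 `^ (- alpha) * x.2 `^ beta).
  move=> Px Py; apply/andP; split; first exact: (kernel_ge0 hypK).
  exact: (kernel_upper hypK).
have r_bounds x : phase x -> 0 <= r x <= R1 * x.1 `^ mu * x.2 `^ sigma.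
  move=> Px; apply/andP; split; last exact: (rate_upper hypr).
  apply: le_trans (rate_lower hypr Px).
  exact: mulr_ge0 (mulr_ge0 (ltW R00) (powR_ge0 _ _)) (powR_ge0 _ _).
have volume_moments x1 s : x1_set gamma mu sigma x1 -> 0 <= s ->
    (moment (g s) (fun _ v => (v `^ x1)%R) <= (C1 v0 K0 K1 gamma)%:E)%E.
  move=> hx s0; apply: le_trans (volume x1 hx).
  by apply: ereal_sup_ubound; exists s => //=; rewrite in_itv/= s0.
have I0 : (0 : R) <= 0 <= t by apply/andP; split.
have It : 0 <= t <= t by apply/andP; split.
move: area0; rewrite (moment_area alpha0 mu0 eps01 (bound _ I0)).
rewrite (moment_area alpha0 mu0 eps01 (bound _ It)) !lee_fin => area0.
exact: (area_exponential_growth alpha0 mu0 beta01 eps01 gamma01 v00 K00 C10 R10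
  R1v0 homogeneity sol bound hK r_bounds volume_moments t_gt0 area0).
Qed.
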